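(* Let $\widehat{\mathcal{H}}_c(n)$ denote the supremum of the number of crossing limit cycles over all planar piecewise polynomial Hamiltonian vector fields of degree at most $n$ with discontinuity line $\{x=0\}$. Then \[ \liminf_{n\to\infty}\frac{\widehat{\mathcal{H}}_c(n)}{n\log n}\ \ge\ \frac{1}{2\log 2}. \]
   Context: A planar piecewise polynomial vector field is $Z=(P,Q)$ with $(P,Q)=(P^+,Q^+)$ for $x>0$ and $(P,Q)=(P^-,Q^-)$ for $x<0$, where $P^\pm,Q^\pm$ are real polynomials in $(x,y)$. Trajectories follow the Filippov convention. Set $\deg P=\max\{\deg P^+,\deg P^-\}$ and similarly $\deg Q$. It is a piecewise polynomial Hamiltonian vector field if both $(P^+,Q^+)$ and $(P^-,Q^-)$ are Hamiltonian, i.e. $(P^\pm,Q^\pm)=(\partial_y H^\pm,-\partial_x H^\pm)$ for some polynomials $H^+,H^-$. A point $(0,y)$ is a crossing point if $P^+(0,y)P^-(0,y)>0$; there, trajectories of one side are continued by trajectories of the other side. A crossing limit cycle is a limit cycle (isolated periodic orbit) of $Z$ that intersects the discontinuity line $\{x=0\}$ and crosses it transversely, i.e. meets it only at (finitely many) crossing points. Let $\pi_c(P,Q)$ be the number of crossing limit cycles of $Z$, and \[ \widehat{\mathcal{H}}_c(n):=\sup\{\pi_c(P,Q):\ (P^\pm,Q^\pm)\text{ Hamiltonian},\ \deg P\le n,\ \deg Q\le n\}\in\mathbb{N}\cup\{0,\infty\}. \] *)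

(* Defs.v *)
From HB Require Import structures.
From mathcomp Require Import all_boot all_order all_algebra.
From mathcomp Require Import all_classical all_reals all_analysis.
(* Without its notations, which clash with those of analysis. *)
From mathcomp Require Import -(notations) mpoly.
Set Implicit Arguments.
Unset Strict Implicit.
Unset Printing Implicit Defensive.
Import Order.TTheory GRing.Theory Num.Theory.
Import numFieldNormedType.Exports.
Local Open Scope classical_set_scope.
Local Open Scope ring_scope.

(* Real polynomials in (x, y); x is variable 0 and y is variable 1. *)
Notation poly2 R := (mpoly 2 R).

Section PiecewiseFields.
Variable R : realType.
Implicit Types (p : R * R) (h : poly2 R).

(* msize is the total degree plus one, and 0 for the zero polynomial. *)
Definition deg h : nat := (msize h).-1.

Definition eval2 h p : R :=
  meval (fun i : 'I_2 => if i == 0 then p.1 else p.2) h.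

Definition dx h : poly2 R := mderiv (0 : 'I_2) h.
Definition dy h : poly2 R := mderiv (1 : 'I_2) h.

(* (Pp, Qp) is the field on x > 0 and (Pm, Qm) the field on x < 0. *)
Record pw_field := PwField {
  Pp : poly2 R; Qp : poly2 R; Pm : poly2 R; Qm : poly2 R }.

Implicit Types (Z : pw_field) (G : set (R * R)).

Definition degP Z : nat := maxn (deg (Pp Z)) (deg (Pm Z)).
Definition degQ Z : nat := maxn (deg (Qp Z)) (deg (Qm Z)).

Definition hamiltonian_pair (P Q : poly2 R) : Prop :=
  exists H : poly2 R, P = dy H /\ Q = - dx H.

Definition pw_hamiltonian Z : Prop :=
  hamiltonian_pair (Pp Z) (Qp Z) /\ hamiltonian_pair (Pm Z) (Qm Z).

Definition Zp Z p : R * R := (eval2 (Pp Z) p, eval2 (Qp Z) p).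
Definition Zm Z p : R * R := (eval2 (Pm Z) p, eval2 (Qm Z) p).

(* Filippov's set-valued field: on the discontinuity line it is the convex
   hull of the two one-sided values. *)
Definition filippov Z p : set (R * R) :=
  if 0 < p.1 then [set Zp Z p]
  else if p.1 < 0 then [set Zm Z p]
  else [set v | exists2 l : R, 0 <= l <= 1 &
                  v = l *: Zp Z p + (1 - l) *: Zm Z p].

Definition abs_continuous_on (a b : R) (g : R -> R * R) : Prop :=
  forall e : R, 0 < e -> exists2 d : R, 0 < d &
  forall (n : nat) (s t : 'I_n -> R),
    (forall i, [/\ a <= s i, s i <= t i & t i <= b]) ->
    trivIset [set: 'I_n] (fun i => `]s i, t i[%classic) ->
    \sum_(i < n) (t i - s i) < d ->
    \sum_(i < n) `|g (t i) - g (s i)| < e.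

(* Filippov solutions, defined for all times. *)
Definition trajectory Z (g : R -> R * R) : Prop :=
  (forall a b : R, abs_continuous_on a b g) /\
  {ae @lebesgue_measure R, forall t : R,
     derivable g t 1 /\ filippov Z (g t) ('D_1 g t)}.

(* Equilibria are not periodic orbits. *)
Definition periodic_orbit Z G : Prop :=
  exists g : R -> R * R,
    [/\ trajectory Z g,
        exists2 T : R, 0 < T & forall t, g (t + T) = g t,
        exists t, g t <> g 0
      & G = range g].

Definition limit_cycle Z G : Prop :=
  periodic_orbit Z G /\
  exists U : set (R * R),
    [/\ open U, G `<=` U &
        forall G', periodic_orbit Z G' -> G' `<=` U -> G' = G].

Definition disc_line : set (R * R) := [set p | p.1 = 0].

Definition crossing_point Z p : Prop :=
  disc_line p /\ 0 < eval2 (Pp Z) p * eval2 (Pm Z) p.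

Definition crossing_limit_cycle Z G : Prop :=
  [/\ limit_cycle Z G,
      G `&` disc_line !=set0,
      finite_set (G `&` disc_line)
    & G `&` disc_line `<=` crossing_point Z].

(* The number of crossing limit cycles, +oo when there are infinitely many. *)
Definition pi_c Z : \bar R := counting (crossing_limit_cycle Z).

Definition Hc (n : nat) : \bar R :=
  ereal_sup [set pi_c Z | Z in
    [set Z | [/\ pw_hamiltonian Z, (degP Z <= n)%N & (degQ Z <= n)%N]]].

End PiecewiseFields.

(* Main.v *)
(* Take H+ = f(y) - x and H- = g(y) + x with f, g polynomials in one variable:
   on x > 0 an orbit climbs along a translate of the graph of f, on x < 0 it
   descends along a translate of the graph of g.  Crossing periodic orbits through
   (0, a) and (0, b), a < b, are then given by f(a) = f(b), g(a) = g(b) and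
   f > f(a), g > g(a) on ]a, b[; they are isolated as soon as f' and g' are not
   proportional at a and b.

   Cycles are produced by a doubling argument.  The substitution y -> y^2 - c lifts
   each of N such cycles to two, and surrounds them by a continuum of symmetric
   periodic orbits through (0, -y) and (0, y).  Adding a small odd polynomial to
   the lift of g keeps the lifted cycles, and of the continuum keeps one cycle
   for each positive zero of this polynomial.  From degree d to degree 2d the number
   of cycles thus goes from N to 2N + d - 1, whence d log2(d) / 2 asymptotically. *)
Require Import Defs.
From mathcomp Require Import all_boot all_order all_algebra.
From mathcomp Require Import all_classical all_reals all_analysis.
From mathcomp Require Import polyrcf.
From mathcomp Require Import -(notations) mpoly.
From mathcomp Require Import ring lra zify.
Set Implicit Arguments.
Unset Strict Implicit.
Unset Printing Implicit Defensive.
Import Order.TTheory GRing.Theory Num.Theory.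
Import numFieldNormedType.Exports.
Local Open Scope classical_set_scope.
Local Open Scope ring_scope.

(** * Simple cycles *)

(** Isolation is required among all Filippov periodic orbits: a solution is only absolutely
    continuous, and its motion has to be recovered from a differential inclusion that holds almost
    everywhere. The shape of the Hamiltonians makes this tractable: [y] moves at unit speed on
    either side, so orbits are polynomial in time between visits to the line, and a periodic orbit
    cannot avoid the line. Nonproportionality of f' and g' means that the curves f(u) = f(v) and
    g(u) = g(v) of the (u, v)-plane cross transversally. It is used through a combination of f and g
    that increases near both ends, which gives the persistence of cycles under perturbation and also
    a Lyapunov function for their isolation. The term d - 1 of the recurrence comes from degrees: an
    odd polynomial of degree below 2d has at most d - 1 positive zeros. Starting with no cycle at an
    arbitrary degree, instead of degree 1, allows degrees close to any n, as a lower limit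
    demands. *)

Section PolynomialFacts.
Variable R : realType.
Implicit Types (p q : {poly R}) (a b c d e x y : R).

Lemma horner_incr p a b : (forall x, a <= x <= b -> 0 < p^`().[x]) ->
  forall x y, a <= x -> x < y -> y <= b -> p.[x] < p.[y].
Proof.
move=> p'_gt0 x y ax xy yb; apply: (@ltr_hornerW _ p a b) => //.
- by move=> z; rewrite in_itv/= => /andP[/ltW az /ltW zb]; rewrite p'_gt0 ?az.
- by rewrite in_itv/= ax (le_trans (ltW xy)).
- by rewrite in_itv/= yb (le_trans ax (ltW xy)).
Qed.

Lemma horner_decr p a b : (forall x, a <= x <= b -> p^`().[x] < 0) ->
  forall x y, a <= x -> x < y -> y <= b -> p.[y] < p.[x].
Proof.
move=> p'_lt0 x y ax xy yb; rewrite -ltrN2 -!hornerN.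
apply: (@horner_incr _ a b) => // z /p'_lt0.
by rewrite derivN hornerN oppr_gt0.
Qed.

Lemma horner_min_gt p a b c : a <= b -> (forall x, a <= x <= b -> c < p.[x]) ->
  exists2 m, c < m & forall x, a <= x <= b -> m <= p.[x].
Proof.
move=> ab c_lt; have [|z] := @EVT_min R (horner p) a b ab.
  by apply: continuous_subspaceT; exact: continuous_horner.
rewrite in_itv/= => zab z_min; exists p.[z]; first exact: c_lt.
by move=> x xab; apply: z_min; rewrite in_itv.
Qed.

Lemma horner_near_gt p x c : c < p.[x] -> \forall y \near x, c < p.[y].
Proof. by move=> cpx; exact: (cvgr_gt p.[x] (@continuous_horner R p x)). Qed.

Lemma horner_near_lt p x c : p.[x] < c -> \forall y \near x, p.[y] < c.
Proof. by move=> cpx; exact: (cvgr_lt p.[x] (@continuous_horner R p x)). Qed.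

Lemma horner_ivt p a b c : a <= b -> p.[a] < c < p.[b] ->
  exists2 x, a < x < b & p.[x] = c.
Proof.
move=> ab /andP[pac cpb].
have [|x] := @poly_ivtoo R (p - c%:P) a b ab.
  by rewrite !hornerE nmulr_rlt0 ?subr_lt0 ?subr_gt0.
rewrite in_itv => xab; rewrite /root !hornerE subr_eq0 => /eqP pxc.
by exists x.
Qed.

(** Compactness: [p] has a positive minimum on the interval and [q] is bounded there, so one
    threshold for [e] serves all points. The inequalities to be preserved under perturbation are
    brought to this form below. *)
Lemma horner_perturb_gt0 p q a b : (forall x, a <= x <= b -> 0 < p.[x]) ->
  \forall e \near 0^'+, forall x, a <= x <= b -> 0 < p.[x] + e * q.[x].
Proof.
move=> p_gt0; case: (leP a b) => [ab|ba]; last first.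
  by near=> e => x /andP[ax xb]; move: (le_lt_trans (le_trans ax xb) ba); rewrite ltxx.
have [m m_gt0 m_le] := horner_min_gt ab p_gt0.
have [k qk] := poly_itv_bound q a b.
have k1_gt0 : 0 < `|k| + 1 by rewrite ltr_wpDl.
near=> e => x xab; rewrite -(opprK (e * _)) subr_gt0.
apply: (lt_le_trans _ (m_le _ xab)); rewrite -mulrN.
have e_gt0 : 0 < e by near: e; exact: nbhs_right_gt.
have : e < m / (`|k| + 1) by near: e; apply: nbhs_right_lt; rewrite divr_gt0.
rewrite ltr_pdivlMr//; apply: le_lt_trans; rewrite ler_pM2l//.
have := qk _ xab; have := ler_norm k; have := ler_norm (- q.[x]).
by rewrite normrN; lra.
Unshelve. all: by end_near. Qed.

Lemma perturb_gt0 c d : 0 < c -> \forall e \near 0^'+, 0 < c + e * d.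
Proof.
move=> c_gt0; have : forall x, 0 <= x <= 0 -> 0 < c%:P.[x] by move=> x _; rewrite hornerC.
move=> /(@horner_perturb_gt0 c%:P d%:P 0 0); apply: filterS => e /(_ 0).
by rewrite lexx !hornerC; apply.
Qed.

Lemma near_closed_ball (P : R -> Prop) x : (\forall y \near x, P y) ->
  exists2 d, 0 < d & forall y, `|y - x| <= d -> P y.
Proof.
move=> /nbhs_ballP[d/= d_gt0 dP]; exists (d / 2); first by rewrite divr_gt0.
move=> y yd; apply: dP; rewrite /ball/= distrC; apply: le_lt_trans yd _.
by rewrite ltr_pdivrMr// ltr_pMr// ltr1n.
Qed.

End PolynomialFacts.

Section SimpleCycles.
Variable R : realType.
Implicit Types (f g h : {poly R}) (p : R * R).

Definition hump f p :=
  [/\ f.[p.1] = f.[p.2], (forall y, p.1 < y < p.2 -> f.[p.1] < f.[y]),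
      0 < f^`().[p.1] & f^`().[p.2] < 0].

(** The return map has derivative f'(a) g'(b) / (f'(b) g'(a)) at [a] = [p.1], with [b] = [p.2]; the
    last condition says that it is not 1. *)
Definition simple_cycle f g p :=
  [/\ p.1 < p.2, hump f p, hump g p &
      f^`().[p.1] * g^`().[p.2] != f^`().[p.2] * g^`().[p.1]].

(** The strict inequality of [hump] degenerates at the ends of the open interval. Replaced there by
    the sign of f', it leaves only strict inequalities on compact intervals, which are stable. *)
Lemma hump_intro f (a a' b' b : R) : a < a' -> b' < b -> f.[a] = f.[b] ->
  (forall y, a <= y <= a' -> 0 < f^`().[y]) ->
  (forall y, b' <= y <= b -> f^`().[y] < 0) ->
  (forall y, a' <= y <= b' -> f.[a] < f.[y]) -> hump f (a, b).
Proof.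
move=> aa' b'b fab f_incr f_decr f_gt; split => //=.
- move=> y /andP[ay yb]; case: (ltP y a') => [ya'|a'y].
    exact: (horner_incr f_incr (lexx _) ay (ltW ya')).
  case: (ltP b' y) => [b'y|yb']; last by apply: f_gt; rewrite a'y.
  by rewrite fab; apply: (horner_decr f_decr (ltW b'y) yb (lexx _)).
- by apply: f_incr; rewrite lexx ltW.
- by apply: f_decr; rewrite lexx ltW.
Qed.

Lemma hump_near f (a b : R) : a < b -> hump f (a, b) ->
  exists d : R, [/\ 0 < d, a + d < b - d,
    forall y, `|y - a| <= d -> 0 < f^`().[y] &
    forall y, `|y - b| <= d -> f^`().[y] < 0].
Proof.
move=> ab [_ _ /= fa_gt0 fb_lt0].
have [d1 d1_gt0 d1P] := near_closed_ball (horner_near_gt fa_gt0).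
have [d2 d2_gt0 d2P] := near_closed_ball (horner_near_lt fb_lt0).
exists (Num.min (Num.min d1 d2) ((b - a) / 4)); split.
- by rewrite !lt_min d1_gt0 d2_gt0 divr_gt0// subr_gt0.
- have : Num.min (Num.min d1 d2) ((b - a) / 4) <= (b - a) / 4.
    by rewrite ge_min lexx orbT.
  by move=> ?; lra.
- by move=> y; rewrite !le_min => /andP[/andP[+ _] _]; exact: d1P.
- by move=> y; rewrite !le_min => /andP[/andP[_ +] _]; exact: d2P.
Qed.

(** As [h] agrees at both ends, the pair itself still satisfies the level equation and does not have
    to move. *)
Lemma hump_perturb f h (a b : R) : a < b -> hump f (a, b) -> h.[a] = h.[b] ->
  \forall e \near 0^'+, hump (f + e *: h) (a, b).
Proof.
move=> ab fab hab; have [d [d_gt0 abd f_incr f_decr]] := hump_near ab fab.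
case: fab => /= fab f_gt _ _.
have E1 y : a <= y <= a + d -> 0 < f^`().[y].
  by move=> ?; apply: f_incr; rewrite ler_distl; lra.
have E2 y : b - d <= y <= b -> 0 < (- f^`()).[y].
  by move=> ?; rewrite hornerN oppr_gt0; apply: f_decr; rewrite ler_distl; lra.
have E3 y : a + d <= y <= b - d -> 0 < (f - f.[a]%:P).[y].
  by move=> ?; rewrite !hornerE subr_gt0; apply: f_gt; lra.
near=> e; apply: (@hump_intro _ a (a + d) (b - d) b).
- lra.
- lra.
- by rewrite !hornerE fab hab.
- move=> y yP; rewrite derivD derivZ !hornerE; move: y yP.
  by near: e; exact: horner_perturb_gt0.
- move=> y yP; rewrite -oppr_gt0 derivD derivZ !hornerE opprD -mulrN -!hornerN.
  by move: y yP; near: e; exact: horner_perturb_gt0.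
- move=> y yP; rewrite -subr_gt0 !hornerE.
  have -> : f.[y] + e * h.[y] - (f.[a] + e * h.[a]) =
    (f - f.[a]%:P).[y] + e * (h - h.[a]%:P).[y] by rewrite !hornerE; ring.
  by move: y yP; near: e; exact: horner_perturb_gt0.
Unshelve. all: by end_near. Qed.

(* If [f u = f v] then [mu (g u - g v) = K u - K v] for [K = kappa f + mu g], and
   [K] increases along both branches: this does the work of an implicit function
   theorem. *)
Lemma simple_cycle_near f g p : simple_cycle f g p ->
  exists d kappa mu : R, [/\ 0 < d, p.1 + d < p.2 - d, mu != 0,
    forall y, `|y - p.1| <= d ->
      [/\ 0 < f^`().[y], 0 < g^`().[y] & 0 < (kappa *: f + mu *: g)^`().[y]] &
    forall y, `|y - p.2| <= d ->
      [/\ f^`().[y] < 0, g^`().[y] < 0 & 0 < (kappa *: f + mu *: g)^`().[y]]].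
Proof.
case: p => a b [/= ab fab gab det_neq0].
have [_ _ /= fa fb] := fab; have [_ _ /= ga gb] := gab.
have [df [df0 dfab dfa dfb]] := hump_near ab fab.
have [dg [dg0 _ dga dgb]] := hump_near ab gab.
set D := f^`().[a] * g^`().[b] - f^`().[b] * g^`().[a].
have D0 : D != 0 by rewrite subr_eq0.
(* Cramer's rule: the combination with slope 1 at both [a] and [b]. *)
pose k := (g^`().[b] - g^`().[a]) / D; pose m := (f^`().[a] - f^`().[b]) / D.
have Ka : (k *: f + m *: g)^`().[a] = 1.
  by rewrite derivD !derivZ !hornerE /k /m /D; field.
have Kb : (k *: f + m *: g)^`().[b] = 1.
  by rewrite derivD !derivZ !hornerE /k /m /D; field.
have Ka0 : 0 < (k *: f + m *: g)^`().[a] by rewrite Ka.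
have Kb0 : 0 < (k *: f + m *: g)^`().[b] by rewrite Kb.
have [d1 d10 d1P] := near_closed_ball (horner_near_gt Ka0).
have [d2 d20 d2P] := near_closed_ball (horner_near_gt Kb0).
exists (Num.min (Num.min df dg) (Num.min d1 d2)), k, m; split.
- by rewrite !lt_min df0 dg0 d10.
- have : Num.min (Num.min df dg) (Num.min d1 d2) <= df by rewrite !ge_min lexx.
  by move=> ?; lra.
- by rewrite mulf_neq0 ?invr_eq0// subr_eq0 gt_eqF//; lra.
- move=> y; rewrite !le_min => /andP[/andP[? ?] /andP[? ?]].
  by split; [exact: dfa|exact: dga|exact: d1P].
- move=> y; rewrite !le_min => /andP[/andP[? ?] /andP[? ?]].
  by split; [exact: dfb|exact: dgb|exact: d2P].
Qed.

End SimpleCycles.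

(** * Persistence of simple cycles when [g] is perturbed *)

Section Persistence.
Variable R : realType.
Implicit Types (f g h K : {poly R}) (p : R * R).

(** Let [beta u] be the point of the right branch at the level f(u). The difference K(u) - K(beta u)
    changes sign on [a1, a2], and the intermediate value theorem applies. *)
Lemma level_matching f K (a1 a2 b2 b1 : R) : a1 <= a2 -> b2 <= b1 ->
  (forall y, a1 <= y <= a2 -> 0 < f^`().[y]) ->
  (forall y, b2 <= y <= b1 -> f^`().[y] < 0) ->
  f.[a1] = f.[b1] -> f.[a2] = f.[b2] -> K.[a1] < K.[b1] -> K.[b2] < K.[a2] ->
  exists p, [/\ a1 < p.1 < a2, b2 < p.2 < b1, f.[p.1] = f.[p.2] & K.[p.1] = K.[p.2]].
Proof.
move=> a12 b21 f_incr f_decr fab1 fab2 Kab1 Kab2.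
have cf A : {within A, continuous (horner f)}.
  by apply: continuous_subspaceT; exact: continuous_horner.
have cK A : {within A, continuous (horner K)}.
  by apply: continuous_subspaceT; exact: continuous_horner.
have mono_a : {in `[a1, a2] &, {mono horner f : x y / x <= y}}.
  by apply: ler_horner => y; rewrite in_itv/= => yP; apply: f_incr; lra.
have mono_b : {in `[b2, b1] &, {mono horner f : x y /~ x <= y}}.
  by apply: ger_horner => y; rewrite in_itv/= => yP; apply: f_decr; lra.
have inj_b : {in `[b2, b1] &, injective (horner f)}.
  by move=> x y xb yb /eqP; rewrite eq_le !mono_b// -eq_le eq_sym => /eqP.
have inj_a : {in `[a1, a2] &, injective (horner f)}.
  by move=> x y xa ya /eqP; rewrite eq_le !mono_a// -eq_le => /eqP.
have a1I : a1 \in `[a1, a2] by rewrite in_itv/= lexx.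
have a2I : a2 \in `[a1, a2] by rewrite in_itv/= lexx andbT.
have b1I : b1 \in `[b2, b1] by rewrite in_itv/= lexx andbT.
have b2I : b2 \in `[b2, b1] by rewrite in_itv/= lexx.
have exb u : u \in `[a1, a2] -> exists2 v, v \in `[b2, b1] & f.[v] = f.[u].
  move=> uI; apply: (IVT b21 (cf _)); rewrite -fab1 -fab2.
  by move: (uI); rewrite in_itv/= ge_min le_max !mono_a// => /andP[-> ->]; rewrite orbT.
have exa v : v \in `[b2, b1] -> exists2 u, u \in `[a1, a2] & f.[u] = f.[v].
  move=> vI; apply: (IVT a12 (cf _)); rewrite fab1 fab2.
  by move: (vI); rewrite in_itv/= ge_min le_max !mono_b// => /andP[-> ->]; rewrite orbT.
pose beta u := get [set v | v \in `[b2, b1] /\ f.[v] = f.[u]].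
have betaP u : u \in `[a1, a2] -> beta u \in `[b2, b1] /\ f.[beta u] = f.[u].
  by move=> /exb[v vI fv]; rewrite /beta; case: (@getPex _ [set v | v \in `[b2, b1] /\ f.[v] = f.[u]]) => //; exists v.
have beta1 : beta a1 = b1.
  by have [? e] := betaP _ a1I; apply: inj_b => //; rewrite e.
have beta2 : beta a2 = b2.
  by have [? e] := betaP _ a2I; apply: inj_b => //; rewrite e.
(* A decreasing surjection between segments is continuous. *)
have cbeta : {within `[a1, a2], continuous beta}.
  apply: segment_dec_surj_continuous.
    move=> x y xI yI; have [bx ex] := betaP _ xI; have [by_ ey] := betaP _ yI.
    by rewrite -(mono_a y x)// -ex -ey mono_b.
  move=> v /=; rewrite beta1 beta2 => vI; have [u uI fu] := exa v vI.
  exists u => //; have [? e] := betaP _ uI.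
  by apply: inj_b => //; rewrite e.
pose D u := K.[u] - K.[beta u].
have cD : {within `[a1, a2], continuous D}.
  move=> x; apply: cvgB; first exact: cK.
  by apply: (cvg_comp beta (horner K) (cbeta x)); exact: continuous_horner.
have D1 : D a1 < 0 by rewrite /D beta1 subr_lt0.
have D2 : 0 < D a2 by rewrite /D beta2 subr_gt0.
have [|u uI Du] := @IVT R D a1 a2 0 a12 cD.
  by rewrite ge_min le_max (ltW D1) (ltW D2) orbT.
have [bI fb] := betaP _ uI.
have u1 : u != a1 by apply/eqP => ue; move: D1; rewrite -ue Du ltxx.
have u2 : u != a2 by apply/eqP => ue; move: D2; rewrite -ue Du ltxx.
move: (uI) (bI); rewrite !in_itv/= => /andP[a1u ua2] /andP[b2b bb1].
exists (u, beta u); split => /=.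
- by rewrite !lt_neqAle a1u ua2 u2 eq_sym u1.
- rewrite !lt_neqAle b2b bb1 !andbT; apply/andP; split; apply/eqP => e.
    by case/eqP: u2; apply: inj_a => //; rewrite fab2 e fb.
  by case/eqP: u1; apply: inj_a => //; rewrite fab1 -e fb.
- by rewrite fb.
- by apply/eqP; rewrite -subr_eq0; apply/eqP.
Qed.

(** Equality of f and of K = k f + m g at [u] and [v] gives that of g, as [m] is nonzero. The
    determinant condition follows from signs: f' changes sign between [u] and [v] while K' does not,
    so f' and K' are not proportional, and neither are f' and g'. *)
Lemma bracket_simple_cycle f g (k m a1 a2 a3 b3 b2 b1 : R) :
  a1 < a2 -> a2 < a3 -> a3 < b3 -> b3 < b2 -> b2 < b1 -> m != 0 ->
  (forall y, a1 <= y <= a3 ->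
    [/\ 0 < f^`().[y], 0 < g^`().[y] & 0 < (k *: f + m *: g)^`().[y]]) ->
  (forall y, b3 <= y <= b1 ->
    [/\ f^`().[y] < 0, g^`().[y] < 0 & 0 < (k *: f + m *: g)^`().[y]]) ->
  (forall y, a3 <= y <= b3 -> f.[a2] < f.[y] /\ g.[a2] < g.[y]) ->
  f.[a1] = f.[b1] -> f.[a2] = f.[b2] ->
  (k *: f + m *: g).[a1] < (k *: f + m *: g).[b1] ->
  (k *: f + m *: g).[b2] < (k *: f + m *: g).[a2] ->
  exists p, [/\ simple_cycle f g p, a1 < p.1 < a2 & b2 < p.2 < b1].
Proof.
move=> a12 a23 ab3 b32 b21 m0 near_a near_b mid fab1 fab2 K1 K2.
have sub_a u y : a1 < u < a2 -> u <= y <= a3 -> a1 <= y <= a3.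
  by move=> /andP[/ltW a1u _] /andP[/(le_trans a1u) -> ->].
have sub_b v y : b2 < v < b1 -> b3 <= y <= v -> b3 <= y <= b1.
  by move=> /andP[_ /ltW vb1] /andP[-> yv]; rewrite (le_trans yv).
have f_incr y (yP : a1 <= y <= a3) : 0 < f^`().[y] by case: (near_a y yP).
have g_incr y (yP : a1 <= y <= a3) : 0 < g^`().[y] by case: (near_a y yP).
have f_decr y (yP : b3 <= y <= b1) : f^`().[y] < 0 by case: (near_b y yP).
have g_decr y (yP : b3 <= y <= b1) : g^`().[y] < 0 by case: (near_b y yP).
have [||[u v] /= [uP vP fuv Kuv]] := level_matching (ltW a12) (ltW b21) _ _ fab1 fab2 K1 K2.
- by move=> y /andP[a1y ya2]; apply: f_incr; rewrite a1y (le_trans ya2 (ltW a23)).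
- by move=> y /andP[b2y yb1]; apply: f_decr; rewrite yb1 (le_trans (ltW b32) b2y).
have guv : g.[u] = g.[v].
  by move: Kuv; rewrite !(hornerD, hornerZ) fuv => /addrI /(mulfI m0).
have [/andP[a1u ua2] /andP[b2v vb1]] := (uP, vP).
have ua3 := lt_trans ua2 a23; have b3v := lt_trans b32 b2v.
exists (u, v); split => //; split => /=.
- exact: lt_trans ua3 (lt_trans ab3 b3v).
- apply: (@hump_intro _ _ u a3 b3 v) => //.
  + by move=> y /(sub_a _ _ uP); exact: f_incr.
  + by move=> y /(sub_b _ _ vP); exact: f_decr.
  + move=> y /mid[+ _]; apply: lt_trans.
    exact: (horner_incr f_incr (ltW a1u) ua2 (ltW a23)).
- apply: (@hump_intro _ _ u a3 b3 v) => //.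
  + by move=> y /(sub_a _ _ uP); exact: g_incr.
  + by move=> y /(sub_b _ _ vP); exact: g_decr.
  + move=> y /mid[_ +]; apply: lt_trans.
    exact: (horner_incr g_incr (ltW a1u) ua2 (ltW a23)).
- have [|fu _ Ku] := near_a u; first by rewrite !ltW.
  have [|fv _ Kv] := near_b v; first by rewrite !ltW.
  apply/eqP => det0.
  suff e0 : f^`().[u] * (k *: f + m *: g)^`().[v] = f^`().[v] * (k *: f + m *: g)^`().[u].
    by move: (mulr_gt0 fu Kv); rewrite e0 nmulr_rgt0// ltNge ltW.
  rewrite !derivD !derivZ !hornerD !hornerZ.
  rewrite !mulrDr !(mulrCA _ m) -[in RHS]det0.
  by rewrite (mulrCA _ k) (mulrCA f^`().[v] k) (mulrC f^`().[v]).
Qed.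

(** The brackets around the two ends are chosen for the unperturbed pair, before [e]. Since [f] is
    left alone, its matched levels remain exact; what involves [g] consists of strict inequalities,
    which survive. *)
Lemma simple_cycle_perturb f g h p (d : R) : simple_cycle f g p -> 0 < d ->
  \forall e \near 0^'+, exists p', [/\ simple_cycle f (g + e *: h) p',
    `|p'.1 - p.1| <= d & `|p'.2 - p.2| <= d].
Proof.
move=> fgp d_gt0; have [r [k [m [r_gt0]]]] := simple_cycle_near fgp.
case: p fgp => a b [/= ab [/= fab f_gt _ _] [/= gab g_gt _ _] _] r_ab m0 near_a near_b.
pose s := Num.min r d; have s_gt0 : 0 < s by rewrite lt_min r_gt0.
have sr : s <= r by rewrite ge_min lexx.
have sd : s <= d by rewrite ge_min lexx orbT.
have {}near_a y : a - s <= y <= a + s ->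
    [/\ 0 < f^`().[y], 0 < g^`().[y] & 0 < (k *: f + m *: g)^`().[y]].
  by move=> yP; apply: near_a; rewrite ler_distl; lra.
have {}near_b y : b - s <= y <= b + s ->
    [/\ f^`().[y] < 0, g^`().[y] < 0 & 0 < (k *: f + m *: g)^`().[y]].
  by move=> yP; apply: near_b; rewrite ler_distl; lra.
have f_incr y (yP : a - s <= y <= a + s) : 0 < f^`().[y] by case: (near_a y yP).
have g_incr y (yP : a - s <= y <= a + s) : 0 < g^`().[y] by case: (near_a y yP).
have f_decr y (yP : b - s <= y <= b + s) : f^`().[y] < 0 by case: (near_b y yP).
have g_decr y (yP : b - s <= y <= b + s) : 0 < (- g^`()).[y].
  by rewrite hornerN oppr_gt0; case: (near_b y yP).
set K := k *: f + m *: g in near_a near_b.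
have Ka y (yP : a - s <= y <= a + s) : 0 < K^`().[y] by case: (near_a y yP).
have Kb y (yP : b - s <= y <= b + s) : 0 < K^`().[y] by case: (near_b y yP).
have asbs' : a + s < b - s by lra.
have asbs := ltW asbs'.
have mid_f y : a + s <= y <= b - s -> f.[a] < f.[y] by move=> ?; apply: f_gt; lra.
have mid_g y : a + s <= y <= b - s -> g.[a] < g.[y] by move=> ?; apply: g_gt; lra.
have [mf mf_gt mfP] := horner_min_gt asbs mid_f.
have [mg mg_gt mgP] := horner_min_gt asbs mid_g.
(* Levels of [f] slightly above and slightly below that of the cycle. *)
have [a2 [aa2 a2s f_a2 g_a2]] : exists a2, [/\ a < a2, a2 < a + s, f.[a2] < mf & g.[a2] < mg].
  near (a^'+) => a2; exists a2; split; near: a2.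
  - exact: nbhs_right_gt.
  - by apply: nbhs_right_lt; lra.
  - by apply: cvg_within; exact: horner_near_lt.
  - by apply: cvg_within; exact: horner_near_lt.
have [b2 b2I fb2] : exists2 b2, b - s < b2 < b & f.[b2] = f.[a2].
  have [||x xP] := @horner_ivt R (- f) (b - s) b (- f.[a2]); first lra.
    rewrite !hornerN !ltrN2 -fab (lt_le_trans f_a2) ?mfP ?lexx ?andbT//.
    by apply: (horner_incr f_incr) => //; lra.
  by rewrite hornerN => /oppr_inj ?; exists x.
(* The level of [a1] stays above f(b + s), hence is reached again between [b] and [b + s]. *)
have [a1 [a1a sa1 f_a1]] : exists a1, [/\ a1 < a, a - s < a1 & f.[b + s] < f.[a1]].
  near (a^'-) => a1; exists a1; split; near: a1.
  - exact: nbhs_left_lt.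
  - by apply: nbhs_left_gt; lra.
  - apply: cvg_within; apply: horner_near_gt; rewrite fab.
    by apply: (horner_decr f_decr); lra.
have [b1 b1I fb1] : exists2 b1, b < b1 < b + s & f.[b1] = f.[a1].
  have [||x xP] := @horner_ivt R (- f) b (b + s) (- f.[a1]); first lra.
    rewrite !hornerN !ltrN2 f_a1 andbT -fab.
    by apply: (horner_incr f_incr) => //; lra.
  by rewrite hornerN => /oppr_inj ?; exists x.
(* K(a1) < K(a) = K(b) < K(b1) at the outer pair and K(b2) < K(b) = K(a) < K(a2) at the inner one:
   this is the sign change required by the bracket. *)
have Kab : K.[a] = K.[b] by rewrite /K !hornerE fab gab.
have K1 : 0 < K.[b1] - K.[a1].
  rewrite subr_gt0 (@lt_trans _ _ K.[a])//.
    by apply: (horner_incr Ka); clear -s_gt0 sa1 a1a; lra.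
  by rewrite Kab; apply: (horner_incr Kb); clear -s_gt0 b1I; lra.
have K2 : 0 < K.[a2] - K.[b2].
  rewrite subr_gt0 (@lt_trans _ _ K.[a])//.
    by rewrite Kab; apply: (horner_incr Kb); clear -s_gt0 b2I; lra.
  by apply: (horner_incr Ka); clear -s_gt0 aa2 a2s; lra.
have mid_g2 y : a + s <= y <= b - s -> 0 < (g - g.[a2]%:P).[y].
  by move=> yP; rewrite !hornerE subr_gt0 (lt_le_trans g_a2)// mgP.
near=> e.
set G := g + e *: h; set L := k *: f + m *: G.
have LE y : L.[y] = K.[y] + e * (m *: h).[y] by rewrite /L /K /G !(hornerD, hornerZ); ring.
have L'E y : L^`().[y] = K^`().[y] + e * (m *: h)^`().[y].
  by rewrite /L /K /G !(derivD, derivZ, hornerD, hornerZ); ring.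
have G_incr y : a - s <= y <= a + s -> 0 < G^`().[y].
  rewrite /G derivD derivZ !hornerE; move: y.
  by near: e; exact: horner_perturb_gt0.
have G_decr y : b - s <= y <= b + s -> G^`().[y] < 0.
  rewrite -oppr_gt0 /G derivD derivZ !hornerE opprD -mulrN -!hornerN; move: y.
  by near: e; exact: horner_perturb_gt0.
have La y : a - s <= y <= a + s -> 0 < L^`().[y].
  by rewrite L'E; move: y; near: e; exact: horner_perturb_gt0.
have Lb y : b - s <= y <= b + s -> 0 < L^`().[y].
  by rewrite L'E; move: y; near: e; exact: horner_perturb_gt0.
have L1 : L.[a1] < L.[b1].
  rewrite -subr_gt0 !LE (_ : _ - _ = K.[b1] - K.[a1] +
    e * ((m *: h).[b1] - (m *: h).[a1])); last ring.
  by near: e; exact: perturb_gt0.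
have L2 : L.[b2] < L.[a2].
  rewrite -subr_gt0 !LE (_ : _ - _ = K.[a2] - K.[b2] +
    e * ((m *: h).[a2] - (m *: h).[b2])); last ring.
  by near: e; exact: perturb_gt0.
have mid_G y : a + s <= y <= b - s -> G.[a2] < G.[y].
  rewrite -[G.[a2] < _]subr_gt0.
  rewrite (_ : G.[y] - _ = (g - g.[a2]%:P).[y] + e * (h - h.[a2]%:P).[y]).
    by move: y; near: e; exact: horner_perturb_gt0.
  by rewrite /G !(hornerD, hornerN, hornerC, hornerZ); ring.
have [||||||||[u v] /= [uvP uP vP]] := @bracket_simple_cycle f G k m a1 a2 (a + s) (b - s) b2 b1 _ _ _ _ _ m0 _ _ _ (esym fb1) (esym fb2) L1 L2 => //.
- exact: lt_trans a1a aa2.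
- by case/andP: b2I.
- by case/andP: b2I => _ /lt_trans; apply; case/andP: b1I.
- move=> y /andP[a1y ya]; have yP : a - s <= y <= a + s by rewrite ya (le_trans (ltW sa1)).
  by split; [exact: f_incr|exact: G_incr|exact: La].
- move=> y /andP[by_ yb]; have yP : b - s <= y <= b + s.
    by rewrite by_ (le_trans yb)//; case/andP: b1I => _ /ltW.
  by split; [exact: f_decr|exact: G_decr|exact: Lb].
- move=> y yP; split; last exact: mid_G.
  exact: lt_le_trans f_a2 (mfP _ yP).
exists (u, v); split => //=.
- rewrite ler_distl; clear -uP a1a sa1 aa2 a2s sd; lra.
- rewrite ler_distl; clear -vP b2I b1I sd; lra.
Unshelve. all: by end_near. Qed.

End Persistence.

(** * Doubling the number of cycles *)

Section Doubling.
Variable R : realType.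
Implicit Types (f g h : {poly R}) (p : R * R) (s : seq (R * R)).

Lemma near_in_seq (T : eqType) (F : set_system R) (FF : Filter F) (l : seq T)
    (P : T -> R -> Prop) :
  {in l, forall x, \forall e \near F, P x e} ->
  \forall e \near F, {in l, forall x, P x e}.
Proof.
elim: l => [|z l IHl] Pl; first by near=> e.
have {}IHl : \forall e \near F, {in l, forall x, P x e}.
  by apply: IHl => x xl; apply: Pl; rewrite in_cons xl orbT.
have Pz := Pl z (mem_head _ _).
near=> e => x; rewrite in_cons => /predU1P[->|]; first by near: e.
by move: x; near: e.
Unshelve. all: by end_near. Qed.

(** Points move by at most [d], less than half the smallest distance between two of them, and so
    remain distinct. [Q] depends on [e] and may fail at e = 0: symmetric orbits become simple only
    after perturbation. *)
Lemma perturb_seq (Q : R -> R * R -> Prop) s : uniq s ->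
  {in s, forall p, forall d : R, 0 < d -> \forall e \near 0^'+,
    exists p', [/\ Q e p', `|p'.1 - p.1| <= d & `|p'.2 - p.2| <= d]} ->
  \forall e \near 0^'+, exists s',
    [/\ uniq s', size s' = size s & {in s', forall p, Q e p}].
Proof.
move=> s_uniq sQ.
have : \forall d \near (0 : R)^'+, {in s, forall p, {in s, forall q, p != q ->
    d < Num.max `|p.1 - q.1| `|p.2 - q.2| / 2}}.
  apply: near_in_seq => p ps; apply: near_in_seq => q qs.
  case: (eqVneq p q) => [->|pq]; first by near=> d.
  near=> d => _; near: d; apply: nbhs_right_lt; rewrite divr_gt0// lt_max.
  rewrite !normr_gt0 !subr_eq0 -negb_and; apply: contra pq.
  by case: p q {ps qs} => ? ? [? ?] /= /andP[/eqP-> /eqP->].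
move=> near_gap; have [d d_gt0 gap] : exists2 d, 0 < d & {in s, forall p,
    {in s, forall q, p != q -> d < Num.max `|p.1 - q.1| `|p.2 - q.2| / 2}}.
  near (0 : R)^'+ => d; exists d; last by near: d.
  by near: d; exact: nbhs_right_gt.
have : \forall e \near (0 : R)^'+, {in s, forall p, exists p',
    [/\ Q e p', `|p'.1 - p.1| <= d & `|p'.2 - p.2| <= d]}.
  by apply: near_in_seq => p ps; exact: sQ.
apply: filterS => e eP.
have [p|phi phiP] := @choice _ _ (fun p p' => p \in s ->
    [/\ Q e p', `|p'.1 - p.1| <= d & `|p'.2 - p.2| <= d]).
  by case: (boolP (p \in s)) => [/eP[p' ?]|_]; [exists p'|exists p].
exists (map phi s); split; last 2 first.
- by rewrite size_map.
- by move=> _ /mapP[p ps ->]; case: (phiP p ps).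
rewrite map_inj_in_uniq// => p q ps qs phi_pq.
apply/eqP; apply: contraT => pq; have := gap _ ps _ qs pq.
have [_ + +] := phiP p ps; have [_ + +] := phiP q qs.
rewrite phi_pq ltr_pdivlMr// lt_max.
move=> q1 q2 p1 p2 /orP[|]; rewrite ltNge => /negP[].
  rewrite (le_trans (ler_distD (phi q).1 _ _))// (distrC p.1); lra.
rewrite (le_trans (ler_distD (phi q).2 _ _))// (distrC p.2); lra.
Unshelve. all: by end_near. Qed.

(** A value of [f] far out lies below all the earlier ones since [c], so it is the level of a
    symmetric hump of the folded polynomial. On the bounded part -f is bounded above, and at
    infinity it exceeds this bound. *)
Lemma eventually_decr f (c : R) : (1 < size f)%N -> lead_coef f < 0 ->
  exists x0, forall x, x0 <= x ->
    f^`().[x] < 0 /\ (forall t, c <= t < x -> f.[x] < f.[t]).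
Proof.
move=> sf lf; set q := - f.
have sq : (1 < size q)%N by rewrite size_polyN.
have lq : 0 < lead_coef q by rewrite lead_coefN oppr_gt0.
have lq' : 0 < lead_coef q^`().
  rewrite lead_coefE polyorder.size_deriv coef_deriv prednK -?subn1 ?subn_gt0//.
  by rewrite pmulrn_lgt0 ?subn_gt0// subn1 -lead_coefE.
have [n0 n0P] := poly_pinfty_gt_lc lq'.
have [k kP] := poly_itv_bound q c n0.
have [n1 n1P] := poly_lim_infty (k + 1) lq sq.
exists (Num.max n0 n1) => x; rewrite ge_max => /andP[n0x n1x].
have q'_gt0 y : n0 <= y -> 0 < q^`().[y] by move=> /n0P; exact: lt_le_trans.
split; first by rewrite -oppr_gt0 -hornerN -derivN q'_gt0.
move=> t /andP[ct tx]; rewrite -ltrN2 -!hornerN -/q.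
case: (leP n0 t) => [n0t|/ltW tn0].
  apply: (@horner_incr _ q n0 x) => // y /andP[n0y _]; exact: q'_gt0.
apply: le_lt_trans (ler_norm _) _.
apply: le_lt_trans (kP _ _) _; first by rewrite ct.
by apply: lt_le_trans (n1P _ n1x); rewrite ltrDl.
Qed.

Variable c : R.

(** A fold with critical value [-c], taken at 0: a cycle above [-c] has one lift on each side of
    0. *)
Definition fold_poly : {poly R} := 'X^2 - c%:P.

Lemma horner_fold f (y : R) : (f \Po fold_poly).[y] = f.[y ^+ 2 - c].
Proof. by rewrite horner_comp !hornerE. Qed.

Lemma deriv_fold f (y : R) :
  (f \Po fold_poly)^`().[y] = f^`().[y ^+ 2 - c] * (2 * y).
Proof.
rewrite deriv_comp hornerM horner_fold /fold_poly derivB derivXn derivC.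
by rewrite subr0 hornerMn expr1 hornerX mulr_natl.
Qed.

Definition unfoldr (p : R * R) := (Num.sqrt (p.1 + c), Num.sqrt (p.2 + c)).
(** The negative branch reverses the order, hence the exchange of the two ends. *)
Definition unfoldl (p : R * R) := (- Num.sqrt (p.2 + c), - Num.sqrt (p.1 + c)).

Lemma sqr_sqrt_fold (x : R) : - c < x -> Num.sqrt (x + c) ^+ 2 - c = x.
Proof. by move=> cx; rewrite sqr_sqrtr ?addrK//; lra. Qed.

Lemma fold_itv (a b y : R) : - c < a ->
  Num.sqrt (a + c) < y < Num.sqrt (b + c) -> a < y ^+ 2 - c < b.
Proof.
move=> ca /andP[ay yb]; have y_gt0 : 0 < y := le_lt_trans (sqrtr_ge0 _) ay.
have b_ge0 : 0 <= b + c by rewrite ltW// -sqrtr_gt0 (lt_trans y_gt0 yb).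
have a_ge0 : 0 <= a + c by lra.
have : Num.sqrt (a + c) ^+ 2 < y ^+ 2 by rewrite ltr_pXn2r// ?nnegrE ?sqrtr_ge0// ltW.
have : y ^+ 2 < Num.sqrt (b + c) ^+ 2 by rewrite ltr_pXn2r// ?nnegrE ?sqrtr_ge0// ltW.
by rewrite !sqr_sqrtr//; lra.
Qed.

Lemma hump_unfoldr f p : - c < p.1 -> p.1 < p.2 -> hump f p ->
  hump (f \Po fold_poly) (unfoldr p).
Proof.
case: p => a b /= ca ab [/= fab f_gt fa fb].
have cb := lt_trans ca ab.
split => /=; rewrite ?horner_fold ?deriv_fold ?sqr_sqrt_fold//.
- move=> y /(fold_itv ca) yP; rewrite horner_fold; exact: f_gt.
- by rewrite !mulr_gt0// sqrtr_gt0; lra.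
- by rewrite nmulr_rlt0// mulr_gt0// sqrtr_gt0; lra.
Qed.

Lemma hump_unfoldl f p : - c < p.1 -> p.1 < p.2 -> hump f p ->
  hump (f \Po fold_poly) (unfoldl p).
Proof.
case: p => a b /= ca ab [/= fab f_gt fa fb].
have cb := lt_trans ca ab.
split => /=; rewrite ?horner_fold ?deriv_fold ?sqrrN ?sqr_sqrt_fold//.
- move=> y yP; rewrite horner_fold -fab -sqrrN; apply: f_gt; apply: (fold_itv ca).
  by rewrite ltrNr andbC ltrNl andbC; move: yP => /andP[? ?]; apply/andP; split; lra.
- by rewrite nmulr_rgt0// mulrN oppr_lt0 mulr_gt0// sqrtr_gt0; lra.
- by rewrite pmulr_rlt0// mulrN oppr_lt0 mulr_gt0// sqrtr_gt0; lra.
Qed.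

Lemma simple_cycle_unfoldr f g p : - c < p.1 -> simple_cycle f g p ->
  simple_cycle (f \Po fold_poly) (g \Po fold_poly) (unfoldr p).
Proof.
move=> cp [p12 fp gp det]; have cp2 := lt_trans cp p12.
have s1 : 0 < Num.sqrt (p.1 + c) by rewrite sqrtr_gt0; lra.
have s2 : 0 < Num.sqrt (p.2 + c) by rewrite sqrtr_gt0; lra.
split; [by rewrite ltr_sqrt ?ltrD2r//; lra|exact: hump_unfoldr|exact: hump_unfoldr|].
(* Both products carry the nonzero factor 2 sqrt(p.1 + c) 2 sqrt(p.2 + c), which cancels. *)
rewrite /= !deriv_fold !sqr_sqrt_fold// !(mulrACA _ (2 * _)).
rewrite (mulrC (2 * Num.sqrt (p.1 + c))) (inj_eq (mulIf _))//.
by rewrite !mulf_neq0// ?pnatr_eq0// gt_eqF.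
Qed.

Lemma simple_cycle_unfoldl f g p : - c < p.1 -> simple_cycle f g p ->
  simple_cycle (f \Po fold_poly) (g \Po fold_poly) (unfoldl p).
Proof.
move=> cp [p12 fp gp det]; have cp2 := lt_trans cp p12.
have s1 : 0 < Num.sqrt (p.1 + c) by rewrite sqrtr_gt0; lra.
have s2 : 0 < Num.sqrt (p.2 + c) by rewrite sqrtr_gt0; lra.
split; [by rewrite /= ltrN2 ltr_sqrt ?ltrD2r//; lra|exact: hump_unfoldl|exact: hump_unfoldl|].
rewrite /= !deriv_fold !sqrrN !sqr_sqrt_fold// !(mulrACA _ (2 * _)).
rewrite (mulrC (2 * - Num.sqrt (p.1 + c))) (inj_eq (mulIf _)); first by rewrite eq_sym.
by rewrite !mulf_neq0// ?pnatr_eq0// ?oppr_eq0 gt_eqF.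
Qed.

(* In the folded region both restrictions are even, hence all the symmetric
   orbits are closed; an odd perturbation [h] selects those through its zeros. *)
Lemma simple_cycle_symmetric f g h (b : R) : 0 < b ->
  f^`().[b ^+ 2 - c] < 0 -> g^`().[b ^+ 2 - c] < 0 ->
  (forall t, - c <= t < b ^+ 2 - c -> f.[b ^+ 2 - c] < f.[t]) ->
  (forall t, - c <= t < b ^+ 2 - c -> g.[b ^+ 2 - c] < g.[t]) ->
  h.[b] = 0 -> h.[- b] = 0 -> h^`().[- b] = h^`().[b] -> h^`().[b] != 0 ->
  \forall e \near 0^'+,
    simple_cycle (f \Po fold_poly) (g \Po fold_poly + e *: h) (- b, b).
Proof.
move=> b0 fb gb f_gt g_gt hb hNb h'Nb h'b.
have bb : - b < b by lra.
have hump_b (k : {poly R}) : k^`().[b ^+ 2 - c] < 0 ->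
    (forall t, - c <= t < b ^+ 2 - c -> k.[b ^+ 2 - c] < k.[t]) ->
    hump (k \Po fold_poly) (- b, b).
  move=> kb k_gt; split => /=; rewrite ?horner_fold ?deriv_fold ?sqrrN//.
  - move=> y yP; rewrite horner_fold; apply: k_gt.
    by rewrite lerBrDl subrr sqr_ge0/= ltrD2r; nra.
  - by rewrite mulrN mulrN oppr_gt0 nmulr_rlt0//; lra.
  - by rewrite nmulr_rlt0//; lra.
have hump_g : \forall e \near 0^'+, hump (g \Po fold_poly + e *: h) (- b, b).
  by apply: hump_perturb => //; [exact: hump_b|rewrite hb hNb].
near=> e; have e0 : 0 < e by near: e; exact: nbhs_right_gt.
split => //=; first exact: hump_b; first by near: e.
- rewrite !derivD !derivZ !hornerD !hornerZ !deriv_fold sqrrN h'Nb.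
  (* The terms in [G] cancel, both lifts being even: without [e *: h] the determinant would
     vanish. *)
  rewrite -subr_eq0; set F := f^`().[_]; set G := g^`().[_].
  rewrite (_ : _ - _ = - (F * (2 * b) * (2 * e * h^`().[b]))); last ring.
  rewrite oppr_eq0 !mulf_neq0//; rewrite ?(lt_eqF fb) ?gt_eqF//; lra.
Unshelve. all: by end_near. Qed.

End Doubling.

(** * Iterated doubling: degrees and numbers of cycles *)

Section Growth.
Variable R : realType.
Implicit Types (f g h : {poly R}) (p : R * R) (s : seq (R * R)).

(** [d] is the exact degree of both polynomials. The negative leading coefficients let the next
    doubling find symmetric orbits far out. *)
Definition many_cycles (d N : nat) : Prop := exists f g : {poly R},
  [/\ size f = d.+1, size g = d.+1, lead_coef f < 0, lead_coef g < 0 &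
      exists s, [/\ uniq s, size s = N & {in s, forall p, simple_cycle f g p}]].

Lemma many_cycles0 d : many_cycles d 0.
Proof.
exists (- 'X^d), (- 'X^d); split; rewrite ?size_polyN ?size_polyXn//.
- by rewrite lead_coefN lead_coefXn oppr_lt0.
- by rewrite lead_coefN lead_coefXn oppr_lt0.
- by exists [::]; split.
Qed.

(** An odd polynomial of degree 2n + 1 whose positive zeros, for r > 0, are the square roots of r +
    i, as far out as [r] requires. *)
Definition odd_factor (n : nat) (r : R) : {poly R} :=
  'X * ((\prod_(i < n) ('X - (r + i%:R)%:P)) \Po 'X^2).

Lemma size_odd_factor n r : (size (odd_factor n r) <= n.*2.+2)%N.
Proof.
apply: leq_trans (size_polyMleq _ _) _; rewrite size_polyX/=.
set P := \prod_(i < n) _; have sP : size P = n.+1.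
  by rewrite size_prod_XsubC /index_enum unlock -enumT size_enum_ord.
have := size_comp_poly P 'X^2; rewrite sP size_polyXn/= muln2 => e.
by rewrite ltnS -e; exact: leqSpred.
Qed.

Lemma horner_odd_factor n r (y : R) :
  (odd_factor n r).[y] = y * \prod_(i < n) (y ^+ 2 - (r + i%:R)).
Proof.
rewrite hornerM hornerX horner_comp hornerXn horner_prod; congr (_ * _).
by apply: eq_bigr => i _; rewrite !hornerE.
Qed.

Lemma odd_factor0 n r (i : 'I_n) (y : R) : y ^+ 2 = r + i%:R ->
  (odd_factor n r).[y] = 0.
Proof. by move=> e; rewrite horner_odd_factor (bigD1 i)//= e subrr mul0r mulr0. Qed.

(** Only y^2 enters the right-hand side, so the derivatives at opposite zeros agree; for r > 0 no
    factor vanishes and these zeros are simple. *)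
Lemma deriv_odd_factor n r (i : 'I_n) (y : R) : y ^+ 2 = r + i%:R ->
  (odd_factor n r)^`().[y] =
    2 * y ^+ 2 * \prod_(j < n | j != i) (y ^+ 2 - (r + j%:R)).
Proof.
move=> e; rewrite /odd_factor (bigD1 i)//= comp_polyM comp_polyB comp_polyX comp_polyC.
rewrite mulrA derivM hornerD; set A := 'X * _; set B := _ \Po _.
have A0 : A.[y] = 0 by rewrite /A hornerM hornerD hornerN hornerC hornerXn e subrr mulr0.
have A' : A^`().[y] = 2 * y ^+ 2.
  rewrite /A derivM derivX derivB derivXn derivC subr0 mul1r !(hornerD, hornerM).
  by rewrite hornerN hornerC !hornerXn -e /=; ring.
rewrite [(A^`() * B).[y]]hornerM [(A * _).[y]]hornerM A0 A' mul0r addr0 /B horner_comp horner_prod hornerXn.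
by congr (_ * _); apply: eq_bigr => j _; rewrite !hornerE.
Qed.

(** Such a [c] puts the critical value [-c] of the fold below all the cycles to be lifted. *)
Lemma seq_lower_bound s : exists2 c : R, 0 <= c & {in s, forall p, - c < p.1}.
Proof.
elim: s => [|q s [c c_ge0 cs]]; first by exists 0.
exists (Num.max c (1 - q.1)) => [|p]; first by rewrite le_max c_ge0.
rewrite ltrNl lt_max in_cons => /predU1P[->|/cs]; last by rewrite -ltrNl => ->.
by rewrite orbC; apply/orP; left; lra.
Qed.

(** A single [e] serves both families: the 2N lifts may move slightly, while the [d] symmetric
    orbits keep their ends, which are zeros of [h]. *)
Lemma many_cycles_double d N : many_cycles d.+1 N ->
  many_cycles d.+1.*2 (N.*2 + d).
Proof.
move=> [f [g [sf sg lf lg [s [s_uniq sN scs]]]]].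
have [c c_ge0 cs] := seq_lower_bound s.
have [|xf xfP] := @eventually_decr R f (- c) _ lf; first by rewrite sf.
have [|xg xgP] := @eventually_decr R g (- c) _ lg; first by rewrite sg.
(* For x >= r the folded value x - c is beyond both thresholds of decrease; the summand 1 makes [r]
   positive. *)
pose r : R := Num.max 0 (Num.max xf xg) + c + 1.
have r_gt0 : 0 < r.
  by rewrite ltr_wpDl// addr_ge0// le_max lexx.
have rf x : r <= x -> xf <= x - c.
  rewrite /r; have : xf <= Num.max 0 (Num.max xf xg) by rewrite !le_max lexx orbT.
  lra.
have rg x : r <= x -> xg <= x - c.
  rewrite /r; have : xg <= Num.max 0 (Num.max xf xg) by rewrite !le_max lexx !orbT.
  lra.
pose b (i : 'I_d) : R := Num.sqrt (r + i%:R).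
have ri (i : 'I_d) : r <= r + i%:R by rewrite lerDl.
have b_gt0 i : 0 < b i by rewrite sqrtr_gt0 (lt_le_trans r_gt0).
have b2 i : b i ^+ 2 = r + i%:R by rewrite sqr_sqrtr// ltW// (lt_le_trans r_gt0).
have b_inj : injective b.
  move=> i j /(congr1 (fun x => x ^+ 2)); rewrite !b2 => /addrI /eqP.
  by rewrite eqr_nat => /eqP /val_inj.
pose h := odd_factor d r.
pose T := fold_poly c.
have h'b (i : 'I_d) (y : R) : y ^+ 2 = r + i%:R -> h^`().[y] = h^`().[b i].
  by move=> e; rewrite !(deriv_odd_factor (i := i)) ?b2// e.
have h'b0 (i : 'I_d) : h^`().[b i] != 0.
  rewrite (deriv_odd_factor (b2 i)) b2 !mulf_neq0 ?pnatr_eq0//.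
    by rewrite gt_eqF// (lt_le_trans r_gt0).
  apply/prodf_neq0 => j ji; rewrite subr_eq0 (inj_eq (addrI _)) eqr_nat.
  by apply: contra ji => /eqP /val_inj ->.
pose new := [seq (- b i, b i) | i <- enum 'I_d].
pose s0 := [seq unfoldr c p | p <- s] ++ [seq unfoldl c p | p <- s] ++ new.
have sqrt_inj x y : - c < x -> - c < y -> Num.sqrt (x + c) = Num.sqrt (y + c) -> x = y.
  move=> cx cy e; rewrite -(sqr_sqrt_fold cx) -(sqr_sqrt_fold cy) e.
  by [].
have cs2 : {in s, forall p, - c < p.2}.
  by move=> p ps; have [p12 _ _ _] := scs _ ps; exact: lt_trans (cs _ ps) p12.
(* The signs of the two ends tell the three families apart: (+, +), (-, -) and (-, +). *)
have s0_uniq : uniq s0.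
  rewrite /s0 !cat_uniq; apply/and3P; split; [| |apply/and3P; split].
  - rewrite map_inj_in_uniq// => -[a1 a2] [b1 b2_] /[dup] /cs/= ca1 /cs2/= ca2.
    move=> /[dup] /cs/= cb1 /cs2/= cb2.
    by move=> [/(sqrt_inj _ _ ca1 cb1) -> /(sqrt_inj _ _ ca2 cb2) ->].
  - apply/hasPn => q; rewrite mem_cat => /orP[/mapP[p ps ->]|/mapP[i _ ->]];
      apply/negP => /mapP[p' ps' [e _]]; have := sqrtr_ge0 (p'.1 + c);
      rewrite -e leNgt oppr_lt0 ?b_gt0//.
    by rewrite sqrtr_gt0; have := cs2 _ ps; rewrite ltrNl -subr_gt0 opprK addrC => ->.
  - rewrite map_inj_in_uniq// => -[a1 a2] [b1 b2_] /[dup] /cs/= ca1 /cs2/= ca2.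
    move=> /[dup] /cs/= cb1 /cs2/= cb2.
    by move=> [/oppr_inj/(sqrt_inj _ _ ca2 cb2) -> /oppr_inj/(sqrt_inj _ _ ca1 cb1) ->].
  - apply/hasPn => q /mapP[i _ ->]; apply/negP => /mapP[p ps [_ e]].
    by have := b_gt0 i; rewrite e oppr_gt0 ltNge sqrtr_ge0.
  - by rewrite map_inj_uniq ?enum_uniq// => i j [_ /b_inj].
have s0P : {in s0, forall p, forall e : R, 0 < e -> \forall t \near 0^'+,
    exists p', [/\ simple_cycle (f \Po T) (g \Po T + t *: h) p',
      `|p'.1 - p.1| <= e & `|p'.2 - p.2| <= e]}.
  move=> q; rewrite !mem_cat => /or3P[] /mapP[p ps ->] e e_gt0.
  - by apply: simple_cycle_perturb => //; apply: simple_cycle_unfoldr; [exact: cs|exact: scs].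
  - by apply: simple_cycle_perturb => //; apply: simple_cycle_unfoldl; [exact: cs|exact: scs].
  - have hb : h.[b p] = 0 by exact: odd_factor0 (b2 p).
    have hNb : h.[- b p] = 0 by apply: (odd_factor0 (i := p)); rewrite sqrrN b2.
    have h'Nb : h^`().[- b p] = h^`().[b p] by apply: h'b; rewrite sqrrN b2.
    have [|f' f_gt] := xfP (b p ^+ 2 - c); first by rewrite b2 rf.
    have [|g' g_gt] := xgP (b p ^+ 2 - c); first by rewrite b2 rg.
    have := simple_cycle_symmetric (b_gt0 p) f' g' f_gt g_gt hb hNb h'Nb (h'b0 p).
    apply: filterS => t tP; exists (- b p, b p); split => //=; by rewrite subrr normr0 ltW.
near (0 : R)^'+ => e.
have [s' [s'_uniq s'N s'P]] : exists s', [/\ uniq s', size s' = size s0 &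
    {in s', forall p, simple_cycle (f \Po T) (g \Po T + e *: h) p}].
  by near: e; exact: perturb_seq.
have sT : size T = 3 by rewrite size_XnsubC.
have lT : lead_coef T = 1 by rewrite lead_coefXnsubC.
have size_T (k : {poly R}) : size k = d.+2 -> size (k \Po T) = d.+1.*2.+1.
  move=> sk; have := size_comp_poly k T; rewrite sk sT/= => e0.
  by rewrite -(@prednK (size (k \Po T))) ?e0 ?muln2//; case: (size _) e0.
have lead_T (k : {poly R}) : lead_coef (k \Po T) = lead_coef k.
  by rewrite lead_coef_comp ?sT// lT expr1n mulr1.
(* The degree 2d + 1 of [h] is just below the degree 2d + 2 of the lift, so neither degree nor
   leading coefficient changes. *)
have sh : (size (e *: h) < size (g \Po T))%N.
  rewrite (size_T g)//; apply: leq_ltn_trans (size_scale_leq _ _) _.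
  by apply: leq_ltn_trans (size_odd_factor _ _) _; rewrite doubleS.
exists (f \Po T), (g \Po T + e *: h); split.
- exact: size_T.
- by rewrite size_polyDl// size_T.
- by rewrite lead_T.
- by rewrite lead_coefDl// lead_T.
- exists s'; split => //; rewrite s'N !size_cat (size_map (unfoldr c)) (size_map (unfoldl c)) sN.
  by rewrite size_map size_enum_ord addnA addnn.
Unshelve. all: by end_near. Qed.

(** Solves N(2d) = 2 N(d) + d - 1 with N(m + 1) = 0, namely N = k 2^(k-1) (m + 1) - 2^k + 1, doubled
    and written without subtraction. *)
Lemma many_cycles_pow2 m k : exists2 N,
  many_cycles (2 ^ k * m.+1) N & (2 ^ k.+1 + N.*2 = k * 2 ^ k * m.+1 + 2)%N.
Proof.
elim: k => [|k [N mN eN]]; first by exists 0%N; [exact: many_cycles0|].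
have [d dE] : exists d, (2 ^ k * m.+1 = d.+1)%N.
  by exists (2 ^ k * m.+1).-1; rewrite prednK// muln_gt0 expn_gt0.
exists (N.*2 + d)%N.
  by rewrite expnS -mulnA mul2n dE; apply: many_cycles_double; rewrite -dE.
have -> : (k.+1 * 2 ^ k.+1 * m.+1 = 2 * (k * 2 ^ k * m.+1) + 2 * (2 ^ k * m.+1))%N.
  by rewrite expnS; ring.
by rewrite dE; move: eN; rewrite (expnS 2 k.+1); lia.
Qed.

End Growth.

(** * Absolutely continuous functions *)

Section AbsoluteContinuity.
Variable R : realType.
Implicit Types (a b c x y : R) (u : R -> R).

Definition ac_on a b u : Prop :=
  forall e : R, 0 < e -> exists2 d : R, 0 < d &
  forall (n : nat) (s t : 'I_n -> R),
    (forall i, [/\ a <= s i, s i <= t i & t i <= b]) ->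
    trivIset [set: 'I_n] (fun i => `]s i, t i[%classic) ->
    \sum_(i < n) (t i - s i) < d ->
    \sum_(i < n) `|u (t i) - u (s i)| < e.

Lemma ae_imply (P Q : R -> Prop) : (forall t, P t -> Q t) ->
  {ae @lebesgue_measure R, forall t, P t} -> {ae @lebesgue_measure R, forall t, Q t}.
Proof.
move=> PQ [A [mA A0 PA]]; exists A; split=> // t nQt; apply: PA => Pt.
by apply: nQt; exact: PQ.
Qed.

(** Continuous induction, as in Cousin's lemma: the supremum of the points reached from [a] can be
    passed unless it is [b]. Local intervals contain [c], as suits differentiability at [c]. *)
Lemma cousin_induction (Q : R -> R -> Prop) a b : a <= b ->
  (forall x y z, x <= y -> y <= z -> Q x y -> Q y z -> Q x z) ->
  (forall c, a <= c <= b -> exists2 d, 0 < d & forall x y,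
     a <= x -> x <= c -> c <= y -> y <= b -> c - d < x -> y < c + d -> Q x y) ->
  Q a b.
Proof.
move=> ab Qtrans Qloc; pose S := [set x | a <= x <= b /\ Q a x].
have Sa : S a.
  split; first by rewrite lexx.
  by have [|d d0] := Qloc a; [rewrite lexx|apply; lra].
have supS : has_sup S by split; [exists a|exists b => x [/andP[]]].
set c := sup S.
have ac : a <= c by exact: ub_le_sup (proj2 supS) _ Sa.
have cb : c <= b by apply: ge_sup; [exists a|move=> x [/andP[]]].
have [|d d0 dQ] := Qloc c; first by rewrite ac.
have [x [/andP[ax xb] Qax] cdx] := sup_adherent d0 supS.
have xc : x <= c by apply: ub_le_sup (proj2 supS) _ _; split=> //; rewrite ax.
pose y := Num.min b (c + d / 2).
have cy : c <= y by rewrite le_min cb lerDl ltW// divr_gt0.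
have yb : y <= b by rewrite ge_min lexx.
have yd : y < c + d by rewrite gt_min ltrD2l ltr_pdivrMr// ltr_pMr// ltr1n orbT.
have Qay : Q a y := Qtrans _ _ _ ax (le_trans xc cy) Qax (dQ _ _ ax xc cy yb cdx yd).
have yc : y <= c by apply: ub_le_sup (proj2 supS) _ _; split=> //; rewrite yb (le_trans ac).
suff -> : b = y by [].
move: yc; rewrite /y; case: (leP b) => // _; move: d0; lra.
Qed.

(** Straddle lemma: the increments on either side of [c] are bounded separately, then added. *)
Lemma is_derive_growth u c (D m : R) : is_derive c 1 u D -> m < D ->
  exists2 d, 0 < d & forall x y, c - d < x -> x <= c -> c <= y -> y < c + d ->
    m * (y - x) <= u y - u x.
Proof.
move=> [uc uD] mD.
have : \forall h \near 0^', m < h^-1 *: ((u \o shift c) (h *: 1) - u c).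
  by apply: (cvgr_gt D) => //; rewrite -uD; exact: uc.
rewrite near_withinE => /nbhs_ballP[d/= d0 dP]; exists d => // x y cdx xc cy ycd.
have slope h : h != 0 -> `|h| < d -> m < h^-1 * (u (h + c) - u c).
  move=> h0 hd; have := dP h; rewrite /= /ball/= sub0r normrN => /(_ hd h0).
  by rewrite scaler1.
have Py : m * (y - c) <= u y - u c.
  have [->|yc] := eqVneq y c; first by rewrite !subrr mulr0.
  have yc0 : 0 < y - c by rewrite subr_gt0 lt_neqAle eq_sym yc.
  have := slope (y - c); rewrite subrK gtr0_norm// gt_eqF//.
  rewrite [_^-1 * _]mulrC ltr_pdivlMr// => h; apply/ltW/h => //; lra.
have Px : m * (c - x) <= u c - u x.
  have [->|xc'] := eqVneq x c; first by rewrite !subrr mulr0.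
  have xc0 : 0 < c - x by rewrite subr_gt0 lt_neqAle xc'.
  have := slope (x - c); rewrite subrK -(opprB c x) normrN gtr0_norm// oppr_eq0 gt_eqF//.
  rewrite invrN mulNr -mulrN opprB mulrC ltr_pdivlMr// => h; apply/ltW/h => //; lra.
lra.
Qed.

Lemma sum_disjoint_itv_le (n : nat) (s t : 'I_n -> R) (U : set R) :
  measurable U -> (forall i, s i <= t i) -> (forall i, `]s i, t i[%classic `<=` U) ->
  trivIset [set: 'I_n] (fun i => `]s i, t i[%classic) ->
  ((\sum_(i < n) (t i - s i))%:E <= @lebesgue_measure R U)%E.
Proof.
move=> mU st sU tst.
have mI i : measurable (`]s i, t i[%classic : set R) by exact: measurable_itv.
have mB : measurable (\big[setU/set0]_(i < n) (`]s i, t i[%classic : set R)).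
  by apply: bigsetU_measurable => i _; exact: mI.
apply: (@le_trans _ _ (lebesgue_measure (\big[setU/set0]_(i < n) (`]s i, t i[%classic : set R)))); last first.
  apply: le_measure; rewrite ?inE//.
  by elim/big_ind: _ => // A B AU BU; rewrite subUset.
rewrite measure_semi_additive_ord//= -sumEFin lee_sum// => i _.
rewrite lebesgue_measure_itv/= lte_fin; case: ltP => // ts.
by rewrite lee_fin subr_le0.
Qed.

(** The price of intervals without control by the derivative: the variation of [u], plus that of the
    polynomial through its Lipschitz constant [K]. *)
Definition gauge_sum u (K : R) (l : seq (R * R)) : R :=
  \sum_(q <- l) (`|u q.2 - u q.1| + K * (q.2 - q.1)).

(* Close to the exceptional null set the variation of [u] is small by absolute
   continuity, elsewhere it is controlled by the derivative. *)
Lemma ac_compare u (phi : {poly R}) a b : a <= b -> ac_on a b u ->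
  {ae @lebesgue_measure R, forall t, a < t < b ->
     derivable u t 1 /\ phi^`().[t] <= 'D_1 u t} ->
  phi.[b] - phi.[a] <= u b - u a.
Proof.
move=> ab uac [A [mA A0 AP]].
have [K K1 KP] := poly_lipshitz phi a b.
have K0 : 0 <= K by rewrite (le_trans ler01).
suff main eta : 0 < eta -> phi.[b] - phi.[a] <= u b - u a + eta * (b - a + 1 + K).
  apply/ler_addgt0Pr => e e0; have C0 : 0 < b - a + 1 + K by lra.
  by have := main (e / (b - a + 1 + K)); rewrite divfK ?gt_eqF//; apply; rewrite divr_gt0.
move=> eta0; have [d d0 dP] := uac _ eta0.
(* The ends join the null set, the hypothesis being about the open interval. *)
pose A2 := A `|` [set a] `|` [set b].
have mAa : measurable (A `|` [set a]) by apply: measurableU => //.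
have mA2 : measurable A2 by apply: measurableU => //.
have A20 : lebesgue_measure A2 = 0%E.
  have s0 x : lebesgue_measure [set x] = 0%E :> \bar R by exact: lebesgue_measure_set1.
  by rewrite /A2 (measureU0 mAa (measurable_set1 b) (s0 b)) (measureU0 mA (measurable_set1 a) (s0 a)).
(* The exceptional intervals will have total length below [d], for absolute continuity, and below
   [eta], for the Lipschitz term. *)
have dm : 0 < Num.min d eta by rewrite lt_min d0 eta0.
have [U [oU A2U UA2]] := lebesgue_regularity_outer mA2 (eq_ind_r (fun z => z < +oo)%E (ltry 0) A20) dm.
have mU : measurable U by exact: measurable_realfun.open_measurable.
have Um : (lebesgue_measure U < (Num.min d eta)%:E)%E.
  apply: le_lt_trans UA2; have le_mU : (lebesgue_measure U <= lebesgue_measure A2 + lebesgue_measure (U `\` A2))%E.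
    by rewrite -{1}(setDUK A2U); apply: measureU2 => //; exact: measurableD.
  by rewrite A20 add0e in le_mU.
(* An additive property of intervals: the list collects the disjoint pieces tagged by points of
   [U]. *)
pose Q x y := exists l : seq (R * R),
  [/\ all (fun q => [&& x <= q.1, q.1 <= q.2 & q.2 <= y]) l,
      pairwise (fun p q => p.2 <= q.1) l,
      forall q, q \in l -> `]q.1, q.2[%classic `<=` U &
      phi.[y] - phi.[x] <= u y - u x + eta * (y - x) + gauge_sum u K l].
have : Q a b.
  apply: cousin_induction => //.
  - move=> x y z xy yz [l1 [a1 p1 U1 s1]] [l2 [a2 p2 U2 s2]].
    exists (l1 ++ l2); split.
    + rewrite all_cat; apply/andP; split.
        by apply: sub_all a1 => q /and3P[-> -> /le_trans ->].
      by apply: sub_all a2 => q /and3P[/(le_trans xy) -> -> ->].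
    + rewrite pairwise_cat p1 p2 !andbT; apply/allrelP => p q /(allP a1)/and3P[_ _ py].
      by move=> /(allP a2)/and3P[yq _ _]; exact: le_trans yq.
    + by move=> q; rewrite mem_cat => /orP[/U1|/U2].
    + by rewrite /gauge_sum big_cat/= -!/(gauge_sum _ _ _); lra.
  - move=> c /andP[ac cb]; have [Uc|nUc] := pselect (U c).
      have [r r0 rU] : exists2 r, 0 < r & forall z, c - r < z < c + r -> U z.
        have /nbhs_ballP[r r0 rU] : nbhs c U by exact: open_nbhs_nbhs.
        by exists r => // z zP; apply: rU; rewrite /ball/= ltr_distlC; lra.
      exists r => // x y ax xc cy yb cx yc; exists [:: (x, y)]; split => //=.
      + by rewrite !lexx (le_trans xc cy).
      + move=> q; rewrite inE => /eqP -> z /=; rewrite in_itv/= => zP.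
        by apply: rU; lra.
      + rewrite /gauge_sum big_seq1/=.
        have yx0 : 0 <= y - x by lra.
        have phi_xy : `|phi.[y] - phi.[x]| <= K * (y - x).
          by have := KP x y; rewrite !in_itv/= (ger0_norm yx0); apply; lra.
        have := ler_norm (phi.[y] - phi.[x]); have := ler_norm (- (u y - u x)).
        rewrite normrN.
        have : 0 <= eta * (y - x) by rewrite mulr_ge0// ltW.
        lra.
    (* Outside [U], u - phi has derivative at least 0, hence above -eta, and the list stays
       empty. *)
    have [uc Duc] : derivable u c 1 /\ phi^`().[c] <= 'D_1 u c.
      apply: contrapT => nP; apply: nUc; apply: A2U.
      have [->|ca] := eqVneq c a; first by left; right.
      have [->|cb'] := eqVneq c b; first by right.
      left; left; apply: AP => /= h; apply: nP; apply: h.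
      by rewrite !lt_neqAle ac cb cb' eq_sym ca.
    have dw : is_derive c 1 (u - horner phi) ('D_1 u c - phi^`().[c]).
      by apply: is_deriveB; exact: derivableP.
    have [|r r0 rP] := @is_derive_growth _ c _ (- eta) dw; first by lra.
    exists r => // x y ax xc cy yb cx yc; exists [::]; split => //.
    have := rP x y cx xc cy yc; rewrite /gauge_sum big_nil !fctE; lra.
move=> [l [al pl Ul lP]].
pose s (i : 'I_(size l)) := (nth (0, 0) l i).1.
pose t (i : 'I_(size l)) := (nth (0, 0) l i).2.
have stP i : [/\ a <= s i, s i <= t i & t i <= b].
  by have /(allP al)/and3P := mem_nth (0, 0) (ltn_ord i).
have tst : trivIset [set: 'I_(size l)] (fun i => `]s i, t i[%classic).
  apply/trivIsetP => i j _ _ ij; rewrite -subset0 => z [/=]; rewrite !in_itv/=.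
  move=> /andP[siz zti] /andP[sjz ztj].
  wlog lt_ij : i j ij siz zti sjz ztj / (i < j)%N.
    move=> H; case: (ltngtP i j) => [/H|/H|/val_inj e]; [exact|apply => //|by rewrite e eqxx in ij].
    by rewrite eq_sym.
  have nthP := pairwiseP (0, 0) pl.
  move: (nthP i j (ltn_ord i) (ltn_ord j) lt_ij); rewrite -/(t i) -/(s j) leNgt.
  by rewrite (lt_trans sjz zti).
have sumU := sum_disjoint_itv_le mU (fun i => let: And3 _ h _ := stP i in h)
  (fun i => Ul _ (mem_nth (0, 0) (ltn_ord i))) tst.
have := le_lt_trans sumU Um; rewrite lte_fin lt_min => /andP[sum_d sum_eta].
have := dP _ _ _ stP tst sum_d => sum_u.
have gE : gauge_sum u K l = \sum_(i < size l) `|u (t i) - u (s i)| + K * \sum_(i < size l) (t i - s i).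
  by rewrite /gauge_sum (big_nth (0, 0)) big_mkord big_split/= mulr_sumr.
have : K * \sum_(i < size l) (t i - s i) <= K * eta by rewrite ler_wpM2l// ltW.
move: lP; rewrite gE; lra.
Qed.

End AbsoluteContinuity.

(** * Solutions and the return map *)

Section Solutions.
Variable R : realType.
Implicit Types (f g : {poly R}) (x y u : R -> R).

(* Filippov solutions of the field [(f' y, 1)] on [x > 0] and [(g' y, -1)] on [x < 0]. *)
Definition solution f g x y : Prop :=
  [/\ forall a b, ac_on a b x, forall a b, ac_on a b y &
   {ae @lebesgue_measure R, forall t, [/\ derivable x t 1 /\ derivable y t 1,
      0 < x t -> 'D_1 x t = f^`().[y t] /\ 'D_1 y t = 1,
      x t < 0 -> 'D_1 x t = g^`().[y t] /\ 'D_1 y t = -1 &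
      x t = 0 -> exists2 l : R, 0 <= l <= 1 &
        'D_1 x t = l * f^`().[y t] + (1 - l) * g^`().[y t]]}].

Lemma ac_onN (a b : R) u : ac_on a b u -> ac_on a b (fun t => - u t).
Proof.
move=> uac e e0; have [d d0 dP] := uac e e0; exists d => // n s t st tst sd.
rewrite (eq_bigr (fun i => `|u (t i) - u (s i)|)) => [|i _]; first exact: dP.
by rewrite -normrN; congr (`|_|); ring.
Qed.

Lemma ac_continuous u : (forall a b : R, ac_on a b u) -> continuous u.
Proof.
move=> uac t; apply/cvgrPdist_lt => e e0.
have [d d0 dP] := uac (t - 1) (t + 1) e e0.
have step (s r : R) : t - 1 <= s -> s <= r -> r <= t + 1 -> r - s < d -> `|u r - u s| < e.
  move=> ts sr rt rsd; have := dP 1%N (fun=> s) (fun=> r); rewrite !big_ord1; apply=> //.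
  by move=> i j _ _ _; rewrite !ord1.
apply/nbhs_ballP; exists (Num.min 1 d) => /=; first by rewrite lt_min ltr01.
move=> s; rewrite /ball/= lt_min ltr_distlC => /andP[/andP[s1 s2]].
rewrite ltr_distlC => /andP[s3 s4].
have [st|/ltW ts] := leP s t; first by apply: step; lra.
by rewrite distrC; apply: step; lra.
Qed.

Lemma first_zero u (a b : R) : continuous u -> 0 < u a -> a <= b -> u b <= 0 ->
  exists2 c, a < c & u c = 0 /\ (forall t, a <= t -> t < c -> 0 < u t).
Proof.
move=> cu ua ab ub.
have cuw A : {within A, continuous u} by exact: continuous_subspaceT.
pose S := [set t | a <= t /\ u t = 0].
have S0 t : a <= t -> u t <= 0 -> exists2 s, S s & s <= t.
  move=> a_t ut; have [|s] := @IVT R u a t 0 a_t (cuw _).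
    by rewrite ge_min le_max ut (ltW ua) orbT.
  by rewrite in_itv/= => /andP[as_ st] us; exists s.
have [s0 Ss0 _] := S0 b ab ub.
have infS : has_inf S by split; [exists s0|exists a => t []].
pose c := inf S.
have ac : a <= c by apply: lb_le_inf => //; [exists s0|move=> t []].
have cS t : S t -> c <= t by move=> St; apply: ge_inf => //; exact: (proj2 infS).
have pos t : a <= t -> t < c -> 0 < u t.
  move=> a_t tc; rewrite ltNge; apply/negP => /(S0 _ a_t)[s /cS cs st].
  by move: (le_lt_trans (le_trans cs st) tc); rewrite ltxx.
have uc : u c = 0.
  apply/eqP/negPn/negP; rewrite neq_lt => /orP[uc|uc].
    have [s [as_ us] sc] := S0 c ac (ltW uc); have := cS s (conj as_ us).
    by move=> cs; move: uc; rewrite (_ : c = s) ?us ?ltxx//; apply/le_anti/andP.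
  have [d d0 dP] := near_closed_ball (cvgr_gt (u c) (cu c) 0 uc).
  have [s [as_ us] scd] := inf_adherent d0 infS.
  have : 0 < u s.
    by apply: dP; rewrite ger0_norm ?subr_ge0 ?cS// lerBlDl ltW.
  by rewrite us ltxx.
exists c => //; rewrite lt_neqAle ac andbT; apply: contraTneq ua => ->.
by rewrite uc ltxx.
Qed.

(** The comparison, applied to [u] and to its opposite. Polynomials suffice, orbits being polynomial
    in time on each side of the line. *)
Lemma ac_eq u (phi : {poly R}) (a b : R) : a <= b -> ac_on a b u ->
  {ae @lebesgue_measure R, forall t, a < t < b ->
     derivable u t 1 /\ 'D_1 u t = phi^`().[t]} ->
  u b - u a = phi.[b] - phi.[a].
Proof.
move=> ab uac uD.
have le1 : phi.[b] - phi.[a] <= u b - u a.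
  by apply: ac_compare => //; apply: (ae_imply _ uD) => t h /h[? ->].
have le2 : (- phi).[b] - (- phi).[a] <= - u b - - u a.
  apply: (@ac_compare _ (fun t => - u t)) => //; first exact: ac_onN.
  apply: (ae_imply _ uD) => t h /h[du Du]; split; first exact: derivableN.
  by rewrite deriveN// Du derivN hornerN.
by move: le2; rewrite !hornerN; lra.
Qed.

(** [y] has speed 1 and is affine in time, so x' = f'(y) is polynomial in time. The second equality
    is conservation of the Hamiltonian. *)
Lemma solution_flow f g x y (s r : R) : solution f g x y -> s <= r ->
  (forall t, s < t < r -> 0 < x t) ->
  y r = y s + (r - s) /\ x r = x s + (f.[y r] - f.[y s]).
Proof.
move=> [xac yac xyD] sr xpos.
have yE t : s <= t <= r -> y t = y s + (t - s).
  move=> /andP[st tr]; suff : y t - y s = ('X : {poly R}).[t] - ('X : {poly R}).[s].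
    by rewrite !hornerX; lra.
  apply: ac_eq => //; apply: (ae_imply _ xyD) => z [[_ dy] pos _ _] /andP[sz zt].
  split=> //; rewrite derivX hornerC.
  by have [|_ ->] := pos; first by apply: xpos; rewrite sz (lt_le_trans zt).
have yr : y r = y s + (r - s) by rewrite yE// sr lexx.
split=> //; pose phi := f \Po ('X + (y s - s)%:P).
have phiE t : phi.[t] = f.[y s + (t - s)].
  by rewrite horner_comp hornerD hornerX hornerC; congr (f.[_]); ring.
suff : x r - x s = phi.[r] - phi.[s].
  by rewrite !phiE subrr addr0 -yr => <-; rewrite addrC subrK.
apply: ac_eq => //; apply: (ae_imply _ xyD) => z [[dx _] pos _ _] /[dup] /andP[/ltW sz /ltW zr] szr.
split=> //; have [|-> _] := pos; first exact: xpos.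
rewrite deriv_comp derivD derivX derivC addr0 mulr1 horner_comp yE ?sz//.
by rewrite hornerD hornerX hornerC; congr (_.[_]); ring.
Qed.

(** Both one-sided speeds exceed [m] near [y t0], hence so do their convex combinations: [x] grows
    whatever its sign, and sliding along the line is excluded. *)
Lemma solution_enters f g x y (t0 : R) : solution f g x y -> x t0 = 0 ->
  0 < f^`().[y t0] -> 0 < g^`().[y t0] ->
  exists2 d, 0 < d & forall t, t0 < t -> t < t0 + d -> 0 < x t.
Proof.
move=> [xac yac xyD] x0 fy gy; have cy := ac_continuous yac.
pose m := Num.min f^`().[y t0] g^`().[y t0] / 2.
have m0 : 0 < m by rewrite divr_gt0// lt_min fy.
have mf : m < f^`().[y t0].
  rewrite ltr_pdivrMr// (le_lt_trans (_ : _ <= f^`().[y t0]))// ?ge_min ?lexx//.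
  by rewrite ltr_pMr// ltr1n.
have mg : m < g^`().[y t0].
  rewrite ltr_pdivrMr// (le_lt_trans (_ : _ <= g^`().[y t0]))// ?ge_min ?lexx ?orbT//.
  by rewrite ltr_pMr// ltr1n.
have [d d0 dP] : exists2 d, 0 < d & forall t, `|t - t0| <= d ->
    m < f^`().[y t] /\ m < g^`().[y t].
  have near_y p : m < p.[y t0] -> \forall t \near t0, m < p.[y t].
    by move=> mp; exact: (cvgr_gt _ (continuous_comp (cy t0) (@continuous_horner R p (y t0))) _ mp).
  by apply: near_closed_ball; near=> t; split; near: t; exact: near_y.
exists d => // t t0t tt0; suff : m * (t - t0) <= x t - x t0.
  by rewrite x0 subr0; apply: lt_le_trans; rewrite mulr_gt0// subr_gt0.
suff : (m *: 'X).[t] - (m *: 'X).[t0] <= x t - x t0 by rewrite !hornerZ !hornerX mulrBr.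
apply: ac_compare => //; first exact: ltW.
apply: (ae_imply _ xyD) => z [[dx _] pos neg zer] /andP[t0z zt]; split=> //.
rewrite derivZ derivX hornerZ hornerC mulr1.
have [|mfz mgz] := dP z; first by rewrite ler_distl; lra.
have [xz|xz|xz] := ltgtP (x z) 0.
- by have [-> _] := neg xz; exact: ltW.
- by have [-> _] := pos xz; exact: ltW.
- by have [l /andP[l0 l1] ->] := zer xz; nra.
Unshelve. all: by end_near. Qed.

(** The orbit must return to the line: while [x] is positive, [y] increases at unit speed, against
    its periodicity. *)
Lemma solution_excursion f g x y (T t0 : R) : solution f g x y -> 0 < T ->
  (forall t, y (t + T) = y t) -> x t0 = 0 ->
  0 < f^`().[y t0] -> 0 < g^`().[y t0] ->
  exists t1, [/\ t0 < t1, x t1 = 0, (forall t, t0 < t < t1 -> 0 < x t) &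
    forall t, t0 <= t <= t1 ->
      y t = y t0 + (t - t0) /\ x t = f.[y t] - f.[y t0]].
Proof.
move=> fgxy T0 yT x0 fy gy; have [xac _ _] := fgxy.
have [d d0 dP] := solution_enters fgxy x0 fy gy.
pose s := t0 + d / 2; have xs : 0 < x s by apply: dP; rewrite /s; lra.
have [b sb xb] : exists2 b, s <= b & x b <= 0.
  apply: contrapT => nb; have xpos t : s <= t -> 0 < x t.
    by move=> st; rewrite ltNge; apply/negP => xt; apply: nb; exists t.
  have [|t|+ _] := @solution_flow f g x y s (s + T) fgxy; first by lra.
    by move=> /andP[/ltW/xpos].
  by rewrite yT; lra.
have [c sc [xc cpos]] := first_zero (ac_continuous xac) xs sb xb.
have pos t : t0 < t < c -> 0 < x t.
  move=> /andP[t0t tc]; have [ts|st] := ltP t s; last exact: cpos.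
  by apply: dP => //; rewrite /s in ts; lra.
exists c; split=> //; first by rewrite /s in sc; lra.
move=> t /andP[t0t tc]; rewrite -[X in _ /\ x t = X]add0r -x0.
apply: (solution_flow fgxy) => // z /andP[t0z zt].
by apply: pos; rewrite t0z (lt_le_trans zt).
Qed.

(** The half-turn (x, y) -> (-x, -y) exchanges the half-planes and reduces excursions on the left to
    excursions on the right. *)
Definition flip f : {poly R} := f \Po (- 'X).

Lemma horner_flip f (z : R) : (flip f).[z] = f.[- z].
Proof. by rewrite horner_comp hornerN hornerX. Qed.

Lemma deriv_flip f (z : R) : (flip f)^`().[z] = - f^`().[- z].
Proof.
by rewrite deriv_comp hornerM derivN derivX horner_comp !hornerE mulrN1.
Qed.

Lemma solution_flip f g x y : solution f g x y ->
  solution (flip g) (flip f) (fun t => - x t) (fun t => - y t).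
Proof.
move=> [xac yac xyD]; split; [by move=> a b; exact: ac_onN..|].
apply: (ae_imply _ xyD) => t [[dx dy] pos neg zer]; split.
- by split; exact: derivableN.
- rewrite oppr_gt0 => /neg[Dx Dy]; rewrite !deriveN// deriv_flip opprK.
  by rewrite Dx Dy opprK.
- rewrite oppr_lt0 => /pos[Dx Dy]; rewrite !deriveN// deriv_flip opprK.
  by rewrite Dx Dy.
- move=> /eqP; rewrite oppr_eq0 => /eqP/zer[l l01 Dx].
  exists (1 - l); first lra.
  by rewrite deriveN// Dx !deriv_flip !opprK; ring.
Qed.

Lemma solution_excursion_neg f g x y (T t0 : R) : solution f g x y -> 0 < T ->
  (forall t, y (t + T) = y t) -> x t0 = 0 ->
  f^`().[y t0] < 0 -> g^`().[y t0] < 0 ->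
  exists t1, [/\ t0 < t1, x t1 = 0, (forall t, t0 < t < t1 -> x t < 0) &
    forall t, t0 <= t <= t1 ->
      y t = y t0 - (t - t0) /\ x t = g.[y t0] - g.[y t]].
Proof.
move=> /solution_flip fgxy T0 yT x0 fy gy.
have [||||t1 [t01 xt1 neg flow]] := solution_excursion fgxy T0 _ _ _ _ (t0 := t0).
- by move=> t; rewrite yT.
- by rewrite x0 oppr0.
- by rewrite deriv_flip opprK oppr_gt0.
- by rewrite deriv_flip opprK oppr_gt0.
exists t1; split=> //.
- by apply/eqP; rewrite -oppr_eq0; apply/eqP.
- by move=> t /neg; rewrite oppr_gt0.
- move=> t /flow[yE xE]; split; first by lra.
  by apply: oppr_inj; rewrite xE !horner_flip !opprK opprB.
Qed.

(** [I] holds at successive returns and [Q] in between. Steps last at least [eta], so returns do not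
    accumulate. *)
Lemma march (I Q : R -> Prop) (eta t0 : R) : 0 < eta ->
  (forall t, I t -> exists t', [/\ t + eta <= t', I t' &
     forall s, t < s <= t' -> Q s]) ->
  I t0 -> forall s, t0 < s -> Q s.
Proof.
move=> eta0 step It0 s t0s.
have q0 : 0 <= (s - t0) / eta by rewrite ltW// divr_gt0// subr_gt0.
have [n] : exists n : nat, s <= t0 + n%:R * eta.
  exists (Num.bound ((s - t0) / eta)); have := ltW (archi_boundP q0).
  by rewrite ler_pdivrMr// lerBlDl.
elim: n t0 It0 t0s {q0} => [|n IHn] t0 It0 t0s sn.
  by move: sn; rewrite mul0r addr0 leNgt t0s.
have [t' [tt' It' Qt']] := step _ It0.
have [st'|t's] := leP s t'; first by apply: Qt'; rewrite t0s.
by apply: (IHn _ It' t's); move: sn; rewrite -natr1 mulrDl mul1r; lra.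
Qed.

End Solutions.

(** * Isolation: periodic solutions that meet the line only near [a] and [b] *)

Section ReturnMap.
Variables (R : realType) (f g : {poly R}) (a b d kappa mu : R).
Local Notation K := (kappa *: f + mu *: g).
Hypothesis abd : a + d < b - d.
Hypotheses (fab : f.[a] = f.[b]) (gab : g.[a] = g.[b]).
Hypothesis near_a : forall y, `|y - a| <= d ->
  [/\ 0 < f^`().[y], 0 < g^`().[y] & 0 < K^`().[y]].
Hypothesis near_b : forall y, `|y - b| <= d ->
  [/\ f^`().[y] < 0, g^`().[y] < 0 & 0 < K^`().[y]].

Lemma near_incr (p : {poly R}) (c : R) :
  (forall y, `|y - c| <= d -> 0 < p^`().[y]) ->
  forall u v, `|u - c| <= d -> `|v - c| <= d -> u < v -> p.[u] < p.[v].
Proof.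
move=> pc u v; rewrite !ler_distl => /andP[cu _] /andP[_ vc] uv.
by apply: (@horner_incr R p (c - d) (c + d)) => // y yP; apply: pc; rewrite ler_distl.
Qed.

Lemma near_decr (p : {poly R}) (c : R) :
  (forall y, `|y - c| <= d -> p^`().[y] < 0) ->
  forall u v, `|u - c| <= d -> `|v - c| <= d -> u < v -> p.[v] < p.[u].
Proof.
move=> pc u v; rewrite !ler_distl => /andP[cu _] /andP[_ vc] uv.
by apply: (@horner_decr R p (c - d) (c + d)) => // y yP; apply: pc; rewrite ler_distl.
Qed.

(** [u -> v -> w] is one turn. If a < u then v < b, so K(v) < K(b) = K(a) < K(u), and f(u) = f(v)
    leaves mu g(v) < mu g(u). Thus mu g is a Lyapunov function of the return map; the sign of [mu]
    tells attraction from repulsion. *)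
Lemma return_order u v w : `|u - a| <= d -> `|v - b| <= d -> `|w - a| <= d ->
  f.[v] = f.[u] -> g.[w] = g.[v] ->
  (a < u -> a < w /\ mu * g.[w] < mu * g.[u]) /\
  (u < a -> w < a /\ mu * g.[u] < mu * g.[w]).
Proof.
move=> ua vb wa fvu gwv.
have d0 : 0 <= d by apply: le_trans ua.
have aa : `|a - a| <= d by rewrite subrr normr0.
have bb : `|b - b| <= d by rewrite subrr normr0.
have fA := near_incr (fun y h => let: And3 k _ _ := near_a h in k).
have gA := near_incr (fun y h => let: And3 _ k _ := near_a h in k).
have KA := near_incr (fun y h => let: And3 _ _ k := near_a h in k).
have fB := near_decr (fun y h => let: And3 k _ _ := near_b h in k).
have gB := near_decr (fun y h => let: And3 _ k _ := near_b h in k).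
have KB := near_incr (fun y h => let: And3 _ _ k := near_b h in k).
have KE z : K.[z] = kappa * f.[z] + mu * g.[z] by rewrite hornerD !hornerZ.
have Kab : K.[a] = K.[b] by rewrite !KE fab gab.
split=> [au|ua'].
- have vb' : v < b.
    have := fA _ _ aa ua au; rewrite -fvu fab => fbv.
    have [//|bv|bv] := ltgtP v b; last by move: fbv; rewrite bv ltxx.
    by have := lt_trans fbv (fB _ _ bb vb bv); rewrite ltxx.
  split.
    have := gB _ _ vb bb vb'; rewrite -gwv -gab => gaw.
    have [//|wa'|wa'] := ltgtP a w; last by move: gaw; rewrite wa' ltxx.
    by have := lt_trans gaw (gA _ _ wa aa wa'); rewrite ltxx.
  have := lt_trans (KB _ _ vb bb vb') (eq_ind _ (fun z => z < _) (KA _ _ aa ua au) _ Kab).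
  by rewrite !KE fvu gwv; lra.
- have bv : b < v.
    have := fA _ _ ua aa ua'; rewrite -fvu fab => fbv.
    have [//|bv|bv] := ltgtP b v; last by move: fbv; rewrite bv ltxx.
    by have := lt_trans fbv (fB _ _ vb bb bv); rewrite ltxx.
  split.
    have := gB _ _ bb vb bv; rewrite -gwv -gab => gaw.
    have [//|wa'|wa'] := ltgtP w a; last by move: gaw; rewrite wa' ltxx.
    by have := lt_trans gaw (gA _ _ aa wa wa'); rewrite ltxx.
  have := lt_trans (eq_ind _ (fun z => _ < z) (KA _ _ ua aa ua') _ Kab) (KB _ _ bb vb bv).
  by rewrite !KE fvu gwv; lra.
Qed.

Variables (x y : R -> R) (T : R).
Hypotheses (fgxy : solution f g x y) (T0 : 0 < T).
Hypotheses (xT : forall t, x (t + T) = x t) (yT : forall t, y (t + T) = y t).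
Hypothesis inU : forall t, x t = 0 -> `|y t - a| <= d \/ `|y t - b| <= d.

(** The arc cannot end near [a], where [f] is increasing: it would reach the same level of [f] at a
    greater height. *)
Lemma upper_half t : x t = 0 -> `|y t - a| <= d -> exists t1,
  [/\ t < t1, x t1 = 0, `|y t1 - b| <= d, f.[y t1] = f.[y t] &
      (forall s, t < s < t1 -> 0 < x s) /\
      forall s, t <= s <= t1 -> y s = y t + (s - t) /\ x s = f.[y s] - f.[y t]].
Proof.
move=> xt ya; have [fy gy _] := near_a ya.
have [t1 [tt1 xt1 pos flow]] := solution_excursion fgxy T0 yT xt fy gy.
have [|yt1 xt1E] := flow t1; first by rewrite lexx ltW.
have fE : f.[y t1] = f.[y t] by lra.
exists t1; split=> //; case: (inU xt1) => // yt1a.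
have fA := near_incr (fun y h => let: And3 k _ _ := near_a h in k).
have /(fA _ _ ya yt1a) : y t < y t1 by lra.
by rewrite fE ltxx.
Qed.

Lemma lower_half t : x t = 0 -> `|y t - b| <= d -> exists t1,
  [/\ t < t1, x t1 = 0, `|y t1 - a| <= d, g.[y t1] = g.[y t] &
      (forall s, t < s < t1 -> x s < 0) /\
      forall s, t <= s <= t1 -> y s = y t - (s - t) /\ x s = g.[y t] - g.[y s]].
Proof.
move=> xt yb; have [fy gy _] := near_b yb.
have [t1 [tt1 xt1 neg flow]] := solution_excursion_neg fgxy T0 yT xt fy gy.
have [|yt1 xt1E] := flow t1; first by rewrite lexx ltW.
have gE : g.[y t1] = g.[y t] by lra.
exists t1; split=> //; case: (inU xt1) => // yt1b.
have gB := near_decr (fun y h => let: And3 _ k _ := near_b h in k).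
have /(gB _ _ yt1b yb) : y t1 < y t by lra.
by rewrite gE ltxx.
Qed.

(** The lower bound on [t2] is the gap between the two windows, climbed at unit speed; it provides
    the uniform step of [march]. *)
Lemma full_turn t : x t = 0 -> `|y t - a| <= d -> exists t1 t2,
  [/\ t + (b - d - (a + d)) <= t2, x t2 = 0, `|y t2 - a| <= d,
      forall s, t < s <= t2 -> x s = 0 -> s = t1 \/ s = t2 &
   [/\ `|y t1 - b| <= d, f.[y t1] = f.[y t], g.[y t2] = g.[y t1],
      (forall s, t <= s <= t1 -> y s = y t + (s - t) /\ x s = f.[y s] - f.[y t]) &
      t < t1 /\ t1 < t2 /\
      (forall s, t1 <= s <= t2 -> y s = y t1 - (s - t1) /\ x s = g.[y t1] - g.[y s])]].
Proof.
move=> xt ya; have [t1 [tt1 xt1 yb f1 [pos flow1]]] := upper_half xt ya.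
have [t2 [t12 xt2 ya2 g2 [neg flow2]]] := lower_half xt1 yb.
exists t1, t2; split=> //.
- have [|y1 _] := flow1 t1; first by rewrite lexx ltW.
  by move: ya yb; rewrite !ler_distl; lra.
- move=> s /andP[ts st2] xs; have [s1|s1|] := ltgtP s t1; last by left.
    by have := pos s; rewrite ts s1 xs ltxx => /(_ isT).
  move: st2; rewrite le_eqVlt => /orP[/eqP ->|st2]; first by right.
  by have := neg s; rewrite s1 st2 xs ltxx => /(_ isT).
Qed.

(** [M] would strictly decrease from return to return, whereas a period restores its initial
    value. *)
Lemma no_monotone_return (P : R -> Prop) (M : R -> R) (t0 : R) :
  (forall u v w, `|u - a| <= d -> `|v - b| <= d -> `|w - a| <= d ->
     f.[v] = f.[u] -> g.[w] = g.[v] -> P u -> P w /\ M w < M u) ->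
  x t0 = 0 -> `|y t0 - a| <= d -> ~ P (y t0).
Proof.
move=> Pstep xt0 ya Py0.
suff /(_ (t0 + T)) : forall s, t0 < s -> x s = 0 -> `|y s - a| <= d -> M (y s) < M (y t0).
  by rewrite xT yT ltxx => h; suff : false by []; apply: h => //; rewrite ltrDl.
pose I t := [/\ x t = 0, `|y t - a| <= d, P (y t) & M (y t) <= M (y t0)].
have eta0 : 0 < b - d - (a + d) by rewrite subr_gt0.
apply: (march (I := I) eta0); last by split.
move=> t [xt yta Pt Mt].
have [t1 [t2 [t2_ge xt2 ya2 zeros [yb1 f1 g2 _ _]]]] := full_turn xt yta.
have [Pt2 Mt2] := Pstep _ _ _ yta yb1 ya2 f1 g2 Pt.
have Mlt := lt_le_trans Mt2 Mt.
exists t2; split=> //; first by split=> //; exact: ltW.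
move=> s sP xs ysa; case: (zeros s sP xs) => [s1|->//].
by move: abd ysa yb1; rewrite s1 !ler_distl; lra.
Qed.

(** On one side of the line [y] moves at unit speed in a fixed direction, which is incompatible with
    its period. *)
Lemma solution_crosses : exists t, x t = 0.
Proof.
have [xac _ _] := fgxy; have cx := ac_continuous xac.
apply: contrapT => nz.
have cxw A : {within A, continuous x} by exact: continuous_subspaceT.
have nzt t : x t != 0 by apply/eqP => xt; apply: nz; exists t.
have sgn s t : s <= t -> x s * x t > 0.
  move=> st; rewrite ltNge; apply/negP => xst.
  have [|c _ xc] := @IVT R x s t 0 st (cxw _).
    rewrite ge_min le_max; have := nzt s; have := nzt t; rewrite !neq_lt.
    by move=> /orP[?|?] /orP[?|?]; (apply/andP; split); apply/orP; nra.
  by apply: nz; exists c.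
have := nzt 0; rewrite neq_lt => /orP[x0|x0].
- have [||y0T _] := @solution_flow R (flip g) (flip f) _ _ 0 T (solution_flip fgxy).
  + exact: ltW.
  + by move=> t /andP[/ltW/sgn]; rewrite nmulr_rgt0// oppr_gt0.
  + by move: y0T; rewrite -[T in y T]add0r yT; move: T0; lra.
- have [||y0T _] := @solution_flow R f g x y 0 T fgxy.
  + exact: ltW.
  + by move=> t /andP[/ltW/sgn]; rewrite pmulr_rgt0.
  + by move: y0T; rewrite -[T in y T]add0r yT; move: T0; lra.
Qed.

Lemma solution_through_a : exists2 t, x t = 0 & y t = a.
Proof.
have [t [xt ya]] : exists t, x t = 0 /\ `|y t - a| <= d.
  have [t xt] := solution_crosses; case: (inU xt) => [?|yb]; first by exists t.
  by have [t1 [_ xt1 ya _ _]] := lower_half xt yb; exists t1.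
exists t => //; apply/eqP/negPn/negP; rewrite neq_lt => /orP[yta|ayt].
- apply: (@no_monotone_return (fun u => u < a) (fun u => - (mu * g.[u])) t) => //.
  move=> u v w ua vb wa fvu gwv u_a; rewrite ltrN2.
  by have [_] := return_order ua vb wa fvu gwv; apply.
- apply: (@no_monotone_return (fun u => a < u) (fun u => mu * g.[u]) t) => //.
  move=> u v w ua vb wa fvu gwv u_a.
  by have [+ _] := return_order ua vb wa fvu gwv; apply.
Qed.

Definition cycle_curve : set (R * R) := [set p | a <= p.2 <= b /\
  (p.1 = f.[p.2] - f.[a] \/ p.1 = g.[a] - g.[p.2])].

Lemma turn_through_a t : x t = 0 -> y t = a ->
  [/\ x (t + (b - a) *+ 2) = 0, y (t + (b - a) *+ 2) = a,
      (forall s, t <= s <= t + (b - a) -> y s = a + (s - t) /\ x s = f.[y s] - f.[a]) &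
      (forall s, t + (b - a) <= s <= t + (b - a) *+ 2 ->
         y s = b - (s - (t + (b - a))) /\ x s = g.[a] - g.[y s])].
Proof.
move=> xt yt; have ya : `|y t - a| <= d.
  have [t1 xt1] := solution_crosses; rewrite yt subrr normr0.
  by case: (inU xt1) => /(le_trans (normr_ge0 _)).
have d0 := le_trans (normr_ge0 _) ya.
have [t1 [t2 [_ xt2 ya2 _ [yb1 f1 g2 flow1 [tt1 [t12 flow2]]]]]] := full_turn xt ya.
have yt1 : y t1 = b.
  have fB := near_decr (fun y h => let: And3 k _ _ := near_b h in k).
  have bb : `|b - b| <= d by rewrite subrr normr0.
  move: f1; rewrite yt fab => f1.
  by have [/(fB _ _ yb1 bb)|/(fB _ _ bb yb1)|//] := ltgtP (y t1) b; rewrite f1 ltxx.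
have yt2 : y t2 = a.
  have gA := near_incr (fun y h => let: And3 _ k _ := near_a h in k).
  have aa : `|a - a| <= d by rewrite subrr normr0.
  move: g2; rewrite yt1 -gab => g2.
  by have [/(gA _ _ ya2 aa)|/(gA _ _ aa ya2)|//] := ltgtP (y t2) a; rewrite g2 ltxx.
have t1E : t1 = t + (b - a).
  by have [|+ _] := flow1 t1; rewrite ?lexx ?ltW// yt1 yt; lra.
have t2E : t2 = t + (b - a) *+ 2.
  by have [|+ _] := flow2 t2; rewrite ?lexx ?ltW// yt2 yt1 t1E mulr2n; lra.
rewrite -t1E -t2E; split=> //.
- by move=> s /flow1; rewrite yt.
- by move=> s /flow2; rewrite yt1 -gab.
Qed.

(** After a passage at [a] the motion is forced, turn after turn; earlier times are brought there by
    adding periods. *)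
Lemma solution_range : [set (x t, y t) | t in setT] = cycle_curve.
Proof.
have [t0 xt0 yt0] := solution_through_a.
have ab : 0 < b - a.
  have [t1 xt1] := solution_crosses.
  by case: (inU xt1) => /(le_trans (normr_ge0 _)); move: abd; lra.
have after s : t0 < s -> cycle_curve (x s, y s).
  have eta0 : 0 < (b - a) *+ 2 by rewrite pmulrn_lgt0.
  apply: (march (I := fun t => x t = 0 /\ y t = a) (Q := fun r => cycle_curve (x r, y r)) eta0) => //.
  move=> t [xt yt]; have [x2 y2 up down] := turn_through_a xt yt.
  exists (t + (b - a) *+ 2); split=> // r /andP[tr rt2].
  have [r1|/ltW r1] := leP r (t + (b - a)).
    have [|yr xr] := up r; first by rewrite (ltW tr).
    by split => /=; [rewrite yr; lra|left].
  have [|yr xr] := down r; first by rewrite r1.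
  split => /=; last by right.
  by move: rt2; rewrite yr mulr2n; lra.
have xyT (n : nat) t : x (t + n%:R * T) = x t /\ y (t + n%:R * T) = y t.
  elim: n => [|n [IHx IHy]]; first by rewrite mul0r addr0.
  by rewrite -natr1 mulrDl mul1r addrA xT yT.
apply/seteqP; split=> [_ [t _ <-]|p [pab px]].
- pose n := Num.bound (`|t0 - t| / T).
  have nT : t0 - t < n%:R * T.
    rewrite -ltr_pdivrMr//; apply: le_lt_trans (archi_boundP _); last first.
      by rewrite divr_ge0// ltW.
    by rewrite ler_pM2r ?invr_gt0// ler_norm.
  have [<- <-] := xyT n t; apply: after; lra.
- have [x2 y2 up down] := turn_through_a xt0 yt0; case: p pab px => p1 p2 /= pab [->|->].
  + have [|ys xs] := up (t0 + (p2 - a)); first by lra.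
    by exists (t0 + (p2 - a)) => //; rewrite xs ys; congr (f.[_] - _, _); ring.
  + have [|ys xs] := down (t0 + (b - a) + (b - p2)); first by rewrite mulr2n; lra.
    by exists (t0 + (b - a) + (b - p2)) => //; rewrite xs ys; congr (_ - g.[_], _); ring.
Qed.

End ReturnMap.

(** * The planar field *)

Section Embedding.
Variable R : realType.
Implicit Types (f g p : {poly R}).

Definition mvar (i : 'I_2) : poly2 R := mpolyX R (mnm1 i).

Definition embed p : poly2 R := (map_poly (mpolyC 2 (R := R)) p).[mvar 1].

Lemma embed0 : embed 0 = 0.
Proof. by rewrite /embed rmorph0 horner0. Qed.

Lemma embedMXaddC p (c : R) : embed (p * 'X + c%:P) = embed p * mvar 1 + mpolyC 2 c.
Proof.
by rewrite /embed rmorphD rmorphM/= map_polyX map_polyC hornerMXaddC.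
Qed.

Lemma eval2_mvar (i : 'I_2) (q : R * R) :
  eval2 (mvar i) q = if i == 0 then q.1 else q.2.
Proof. by rewrite /eval2 mevalXU. Qed.

Lemma eval2_embed p (q : R * R) : eval2 (embed p) q = p.[q.2].
Proof.
elim/poly_ind: p => [|p c IHp]; first by rewrite embed0 /eval2 meval0 horner0.
rewrite embedMXaddC hornerMXaddC -IHp /eval2 mevalD mevalM mevalC.
by rewrite -[meval _ (mvar 1)]/(eval2 (mvar 1) q) eval2_mvar.
Qed.

Lemma mderiv_mvar (i j : 'I_2) : mderiv i (mvar j) = (j == i)%:R.
Proof.
rewrite mderivX mnmE; case: eqP => [->|_]; last by rewrite scale0r.
rewrite scale1r -(mpolyX0 2 R); congr mpolyX; apply/mnmP => k.
by rewrite !mnmE subnn.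
Qed.

Lemma deriv_embed p : dy (embed p) = embed p^`() /\ dx (embed p) = 0.
Proof.
elim/poly_ind: p => [|p c [IHy IHx]].
  by rewrite deriv0 embed0 /dx /dy !mderiv0.
rewrite embedMXaddC derivMXaddC /dx /dy !mderivD !mderivC !addr0 !mderivM.
rewrite -/(dx (embed p)) -/(dy (embed p)) IHy IHx mul0r add0r.
rewrite !mderiv_mvar mulr1 mulr0; split=> //.
by rewrite addrC /embed rmorphD rmorphM/= map_polyX hornerD hornerMX.
Qed.

Lemma msize_embed p : (msize (embed p) <= size p)%N.
Proof.
elim/poly_ind: p => [|p c IHp]; first by rewrite embed0 msize0.
rewrite embedMXaddC size_MXaddC; apply: leq_trans (mmeasureD_le _ _ _) _.
rewrite geq_max mmeasureC; have [->|p0] := eqVneq p 0.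
  by rewrite embed0 mul0r msize0; case: eqVneq.
apply/andP; split; last by case: eqVneq.
have [->|ep0] := eqVneq (embed p) 0; first by rewrite mul0r msize0.
have s1 : msize (mvar 1) = 2 by rewrite /mvar msizeX mdeg1.
have mv0 : mvar 1 != 0 by rewrite -(msize_poly_eq0 (mvar 1)) s1.
by rewrite msizeM// s1 addn2.
Qed.

(* The Hamiltonians are [f(y) - x] and [g(y) + x]: the orbits on either side
   are graphs over the [y]-axis, run upwards for [x > 0] and downwards for [x < 0]. *)
Definition graph_field f g : pw_field R :=
  PwField (embed f^`()) 1 (embed g^`()) (- 1).

Lemma graph_field_hamiltonian f g : pw_hamiltonian (graph_field f g).
Proof.
split; [exists (embed f - mvar 0)|exists (embed g + mvar 0)]; split=> /=.
- by rewrite /dy mderivB -/(dy _) (deriv_embed f).1 mderiv_mvar subr0.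
- by rewrite /dx mderivB -/(dx _) (deriv_embed f).2 mderiv_mvar sub0r opprK.
- by rewrite /dy mderivD -/(dy _) (deriv_embed g).1 mderiv_mvar addr0.
- by rewrite /dx mderivD -/(dx _) (deriv_embed g).2 mderiv_mvar add0r.
Qed.

(** The field contains only derivatives and constants, which allows [f] and [g] of degree n + 1. *)
Lemma graph_field_degree f g n : (size f <= n.+2)%N -> (size g <= n.+2)%N ->
  (degP (graph_field f g) <= n)%N /\ (degQ (graph_field f g) <= n)%N.
Proof.
move=> sf sg; split; rewrite /degP /degQ geq_max /deg /=.
  have le_deg p : (size p <= n.+2)%N -> ((msize (embed p^`())).-1 <= n)%N.
    move=> sp; have := msize_embed p^`(); rewrite polyorder.size_deriv.
    by move: (msize _) (size p) sp => k [|[|l]]; lia.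
  by rewrite !le_deg.
by rewrite mmeasureN mmeasure1.
Qed.

Lemma graph_field_Zp f g q : Defs.Zp (graph_field f g) q = (f^`().[q.2], 1).
Proof. by rewrite /Defs.Zp/= eval2_embed /eval2 meval1. Qed.

Lemma graph_field_Zm f g q : Defs.Zm (graph_field f g) q = (g^`().[q.2], -1).
Proof. by rewrite /Defs.Zm/= eval2_embed /eval2 mevalN meval1. Qed.

Lemma graph_field_crossing f g (y : R) : 0 < f^`().[y] * g^`().[y] ->
  crossing_point (graph_field f g) (0, y).
Proof. by move=> fg; split; rewrite /disc_line/= ?eval2_embed. Qed.

End Embedding.

(** * Coordinates of trajectories, and parametrization modulo a period *)

Section Trajectories.
Variable R : realType.
Implicit Types (f g : {poly R}) (w : R -> R * R).

Lemma derive_pair_components w (t : R) : derivable w t 1 ->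
  is_derive t (1 : R) (fun s => (w s).1) ('D_1 w t).1 /\
  is_derive t (1 : R) (fun s => (w s).2) ('D_1 w t).2.
Proof.
move=> dw; have cw : (fun h => h^-1 *: ((w \o shift t) (h *: (1 : R)) - w t)) @ 0^' --> 'D_1 w t.
  exact: dw.
have c1 : (fun h => h^-1 *: (((fun s => (w s).1) \o shift t) (h *: (1 : R)) - (w t).1)) @ 0^' --> ('D_1 w t).1.
  by apply: (cvg_comp _ fst cw); exact: cvg_fst.
have c2 : (fun h => h^-1 *: (((fun s => (w s).2) \o shift t) (h *: (1 : R)) - (w t).2)) @ 0^' --> ('D_1 w t).2.
  by apply: (cvg_comp _ snd cw); exact: cvg_snd.
split; apply: DeriveDef.
- by apply/cvg_ex; exists ('D_1 w t).1.
- exact: cvg_lim c1.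
- by apply/cvg_ex; exists ('D_1 w t).2.
- exact: cvg_lim c2.
Qed.

Lemma is_derive_pair (u v : R -> R) (t du dv : R) :
  is_derive t (1 : R) u du -> is_derive t (1 : R) v dv ->
  is_derive t (1 : R) (fun s => (u s, v s)) (du, dv).
Proof.
move=> [ut uE] [vt vE].
have cuv : (fun h => h^-1 *: (((fun s => (u s, v s)) \o shift t) (h *: (1 : R)) - (u t, v t))) @ 0^' --> (du, dv).
  rewrite -uE -vE; exact: cvg_pair ut vt.
apply: DeriveDef; first by apply/cvg_ex; exists (du, dv).
exact: cvg_lim cuv.
Qed.

Lemma norm_fst (p : R * R) : `|p.1| <= `|p|.
Proof. by rewrite prod_normE le_max lexx. Qed.

Lemma norm_snd (p : R * R) : `|p.2| <= `|p|.
Proof. by rewrite prod_normE le_max lexx orbT. Qed.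

Lemma trajectory_solution f g w : trajectory (graph_field f g) w ->
  solution f g (fun t => (w t).1) (fun t => (w t).2).
Proof.
move=> [wac wD]; split.
- move=> a b e /(wac a b)[d d0 dP]; exists d => // n s t st tst sd.
  by apply: le_lt_trans (dP n s t st tst sd); apply: ler_sum => i _; exact: norm_fst (w _ - w _).
- move=> a b e /(wac a b)[d d0 dP]; exists d => // n s t st tst sd.
  by apply: le_lt_trans (dP n s t st tst sd); apply: ler_sum => i _; exact: norm_snd (w _ - w _).
- apply: (ae_imply _ wD) => t [dw wF].
  have [[d1 D1] [d2 D2]] := derive_pair_components dw.
  split=> //.
  + rewrite D1 D2 => x0; move: wF; rewrite /filippov x0 graph_field_Zp.
    by move=> /= ->.
  + rewrite D1 D2 => x0; move: wF; rewrite /filippov ltNge (ltW x0)/= x0 graph_field_Zm.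
    by move=> /= ->.
  + rewrite D1 => x0; move: wF; rewrite /filippov x0 ltxx graph_field_Zp graph_field_Zm.
    by move=> /= [l l01 ->]; exists l.
Qed.

Definition lip_on (K s t : R) (u : R -> R) : Prop :=
  forall x y, s <= x -> x <= y -> y <= t -> `|u y - u x| <= K * (y - x).

Lemma lip_glue (K s m t : R) u : lip_on K s m u -> lip_on K m t u -> lip_on K s t u.
Proof.
move=> sm mt x y sx xy yt; have [ym|/ltW my] := leP y m; first exact: sm.
have [mx|/ltW xm] := leP m x; first exact: mt.
rewrite (le_trans (ler_distD (u m) _ _))//.
by have := sm x m sx xm (lexx _); have := mt m y (lexx _) my yt; lra.
Qed.

Lemma abs_continuous_lip w (K a b : R) : 0 < K ->
  (forall x y, x <= y -> `|w y - w x| <= K * (y - x)) -> abs_continuous_on a b w.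
Proof.
move=> K0 wK e e0; exists (e / K) => [|n s t st _]; first by rewrite divr_gt0.
rewrite ltr_pdivlMr// mulrC mulr_sumr; apply: le_lt_trans; apply: ler_sum => i _.
by apply: wK; case: (st i).
Qed.

Variable T : R.
Hypothesis T0 : 0 < T.

Definition turns (t : R) : int := Num.floor (t / T).
Definition phase (t : R) : R := t - (turns t)%:~R * T.

Lemma phase_itv t : 0 <= phase t < T.
Proof.
have /andP[le lt] := floor_itv (t / T).
rewrite /phase subr_ge0 -ler_pdivlMr// le/= ltrBlDl.
by rewrite ltr_pdivrMr// rmorphD mulrDl mul1r in lt.
Qed.

Lemma turns_def t (n : int) : 0 <= t - n%:~R * T < T -> turns t = n.
Proof.
move=> /andP[]; rewrite subr_ge0 ltrBlDl => le lt; apply: floor_def.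
by rewrite ler_pdivlMr// le ltr_pdivrMr// rmorphD mulrDl mul1r.
Qed.

Lemma phaseDT t : phase (t + T) = phase t.
Proof.
have e : t + T - (turns t + 1)%:~R * T = phase t by rewrite /phase rmorphD/=; ring.
by rewrite -e {1}/phase (@turns_def _ (turns t + 1))// e phase_itv.
Qed.

Lemma phase_near t (c d : R) : 0 <= c -> d <= T -> c < phase t < d ->
  \forall s \near t, phase s = s - (turns t)%:~R * T /\ c < phase s < d.
Proof.
move=> c0 dT /andP[cp pd]; near=> s.
have sP : c < s - (turns t)%:~R * T < d.
  apply/andP; split; [rewrite ltrBrDr|rewrite ltrBlDr]; near: s.
    by apply: lt_nbhsr; rewrite -ltrBrDr.
  by apply: lt_nbhsl; rewrite -ltrBlDr.
have -> : phase s = s - (turns t)%:~R * T by rewrite /phase (@turns_def s (turns t))//; lra.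
by [].
Unshelve. all: by end_near. Qed.

(** Only the end of the first period and the beginning of the last one count; u(0) = u(T) makes
    those in between free. *)
Lemma lip_periodic (K : R) u : lip_on K 0 T u -> u 0 = u T ->
  forall x y, x <= y -> `|u (phase y) - u (phase x)| <= K * (y - x).
Proof.
move=> uK u0T x y xy.
have /andP[px0 pxT] := phase_itv x; have /andP[py0 pyT] := phase_itv y.
have [e|ne] := eqVneq (turns x) (turns y).
  have -> : y - x = phase y - phase x by rewrite /phase e; ring.
  apply: uK => //; last exact: ltW.
  by rewrite /phase e lerD2r.
have lt_n : (turns x + 1)%:~R <= (turns y)%:~R :> R.
  rewrite ler_int lezD1 lt_neqAle ne; apply: le_floor.
  by rewrite ler_pM2r ?invr_gt0.
have h1 := uK _ _ px0 (ltW pxT) (lexx _).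
have h2 := uK _ _ (lexx _) py0 (ltW pyT).
have hT : (turns x + 1)%:~R * T <= (turns y)%:~R * T by rewrite ler_pM2r.
have K0 : 0 <= K.
  have := uK 0 T (lexx _) (ltW T0) (lexx _) => /(le_trans (normr_ge0 _)).
  by rewrite subr0 pmulr_lge0.
rewrite u0T in h2; rewrite (le_trans (ler_distD (u T) _ _))//.
have -> : y - x = (T - phase x) + (phase y - 0) + ((turns y)%:~R * T - (turns x + 1)%:~R * T).
  by rewrite /phase rmorphD/=; ring.
have h3 : 0 <= K * ((turns y)%:~R * T - (turns x + 1)%:~R * T).
  by rewrite mulr_ge0// subr_ge0.
by rewrite 2!(mulrDr K); lra.
Qed.

(** The excluded times are multiples of [L], hence form a countable set. *)
Lemma phase_ae (L : R) (P : R -> Prop) : T = L *+ 2 ->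
  (forall t, phase t != 0 -> phase t != L -> P t) ->
  {ae @lebesgue_measure R, forall t, P t}.
Proof.
move=> TL Pphase; pose A := range (fun n : int => n%:~R * L).
have cA : countable A by apply: card_le_trans (card_image_le _ _) (countableP _).
exists A; split.
- by apply: countable_measurable => // t; exact: measurable_set1.
- exact: countable_lebesgue_measure0.
move=> t /= nPt; apply: contrapT => nA; apply: nPt; apply: Pphase.
- apply/eqP => p0; apply: nA; exists (turns t * 2) => //.
  by rewrite rmorphM/=; move: p0; rewrite /phase TL mulr2n; lra.
- apply/eqP => p0; apply: nA; exists (turns t * 2 + 1) => //.
  by rewrite rmorphD rmorphM/=; move: p0; rewrite /phase TL mulr2n; lra.
Qed.

End Trajectories.

(** * The curve of a simple cycle is a crossing limit cycle *)

Section CrossingCycle.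
Variables (R : realType) (f g : {poly R}) (a b : R).
Hypotheses (ab : a < b) (hump_f : hump f (a, b)) (hump_g : hump g (a, b)).
Local Notation L := (b - a).
Local Notation T := ((b - a) *+ 2).

Definition arc_x (r : R) : R :=
  if r <= b - a then f.[a + r] - f.[a] else g.[a] - g.[b + (b - a) - r].
Definition arc_y (r : R) : R :=
  if r <= b - a then a + r else b + (b - a) - r.
Definition cycle_param (t : R) : R * R :=
  (arc_x (phase T t), arc_y (phase T t)).

Lemma T_gt0 : 0 < T.
Proof. by rewrite pmulrn_lgt0// subr_gt0. Qed.

Lemma arc_upper r : r <= L -> arc_x r = f.[a + r] - f.[a] /\ arc_y r = a + r.
Proof. by rewrite /arc_x /arc_y => ->. Qed.

Lemma arc_lower r : L <= r ->
  arc_x r = g.[a] - g.[b + L - r] /\ arc_y r = b + L - r.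
Proof.
rewrite le_eqVlt => /predU1P[<-|Lr]; last by rewrite /arc_x /arc_y leNgt Lr.
have [fab _ _ _] := hump_f; have [gab _ _ _] := hump_g.
rewrite (arc_upper (lexx _)).1 (arc_upper (lexx _)).2 addrK.
by rewrite subrKC fab gab !subrr.
Qed.

Lemma cycle_param_curve t : cycle_curve f g a b (cycle_param t).
Proof.
have /andP[p0 pT] := phase_itv T_gt0 t.
have [pL|/ltW Lp] := leP (phase T t) L; rewrite /cycle_param /cycle_curve/=.
  by have [-> ->] := arc_upper pL; split; [move: p0 pL; lra|left].
have [-> ->] := arc_lower Lp; split; last by right.
by move: pT Lp; rewrite mulr2n; lra.
Qed.

Lemma curve_disc_line : cycle_curve f g a b `&` @disc_line R = [set (0, a); (0, b)].
Proof.
have [/= fab f_gt _ _] := hump_f; have [/= gab g_gt _ _] := hump_g.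
apply/seteqP; split=> [[p1 p2] [[/= /andP[ap pb] pE]]|_ [->|->]]; last 2 first.
- by split=> //; split=> /=; [rewrite lexx ltW|left; rewrite subrr].
- by split=> //; split=> /=; [rewrite lexx ltW|left; rewrite fab subrr].
rewrite /disc_line/= => p10; subst p1.
have [->|pa] := eqVneq p2 a; first by left.
have [->|pb'] := eqVneq p2 b; first by right.
have pI : a < p2 < b by rewrite !lt_neqAle ap pb pb' eq_sym pa.
by exfalso; move: (f_gt _ pI) (g_gt _ pI); case: pE => pE; lra.
Qed.

Lemma cycle_param_derive t : phase T t != 0 -> phase T t != L ->
  derivable cycle_param t 1 /\
  filippov (graph_field f g) (cycle_param t) ('D_1 cycle_param t).
Proof.
have [/= fab f_gt _ _] := hump_f; have [/= gab g_gt _ _] := hump_g.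
move=> p0 pL; have /andP[p_ge0 pT] := phase_itv T_gt0 t.
have p_gt0 : 0 < phase T t by rewrite lt_neqAle eq_sym p0.
have TL : L <= T by rewrite mulr2n; move: ab; lra.
set n := (turns T t)%:~R * T.
have [lt_pL|lt_Lp|/eqP] := ltgtP (phase T t) L; last by rewrite (negPf pL).
- have pI : 0 < phase T t < L by rewrite p_gt0.
  have near_t := phase_near T_gt0 (lexx 0) TL pI.
  (* Near [t] the number of turns is constant and the parametrization is the polynomial curve (P,
     Q). *)
  pose P := f \Po ('X + (a - n)%:P) - (f.[a])%:P; pose Q := 'X + (a - n)%:P : {poly R}.
  have PE s : P.[s] = f.[a + (s - n)] - f.[a].
    by rewrite /P !(hornerD, hornerN, hornerC, horner_comp, hornerX); congr (f.[_] - _); ring.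
  have QE s : Q.[s] = a + (s - n) by rewrite /Q hornerD hornerX hornerC; ring.
  have dPQ := is_derive_pair (is_derive_poly P t) (is_derive_poly Q t).
  have near_PQ : \forall s \near t, (P.[s], Q.[s]) = cycle_param s.
    apply: filterS near_t => s [ps /andP[_ /ltW sL]].
    have [eX eY] := arc_upper sL.
    by rewrite /cycle_param eX eY ps PE QE.
  have [dw Dw] := near_eq_is_derive near_PQ dPQ.
  split=> //; rewrite Dw /filippov.
  have [eX eY] := arc_upper (ltW lt_pL).
  have x_gt0 : 0 < (cycle_param t).1.
    by rewrite /= eX subr_gt0; apply: f_gt; lra.
  rewrite x_gt0 graph_field_Zp/= eY; congr (_, _).
    rewrite derivB derivC subr0 deriv_comp derivD derivX derivC addr0 mulr1.
    rewrite horner_comp hornerD hornerX hornerC; congr (_.[_]); rewrite /phase -/n; ring.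
  by rewrite derivD derivX derivC addr0 hornerC.
- have pI : L < phase T t < T by rewrite lt_Lp.
  have L0 : 0 <= L by rewrite subr_ge0 ltW.
  have near_t := phase_near T_gt0 L0 (lexx T) pI.
  pose Q := (b + L + n)%:P - 'X : {poly R}; pose P := (g.[a])%:P - (g \Po Q).
  have QE s : Q.[s] = b + L - (s - n) by rewrite /Q hornerD hornerN hornerX hornerC; ring.
  have PE s : P.[s] = g.[a] - g.[b + L - (s - n)].
    by rewrite /P hornerD hornerN hornerC horner_comp QE.
  have dPQ := is_derive_pair (is_derive_poly P t) (is_derive_poly Q t).
  have near_PQ : \forall s \near t, (P.[s], Q.[s]) = cycle_param s.
    apply: filterS near_t => s [ps /andP[/ltW Ls _]].
    have [eX eY] := arc_lower Ls.
    by rewrite /cycle_param eX eY ps PE QE.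
  have [dw Dw] := near_eq_is_derive near_PQ dPQ.
  split=> //; rewrite Dw /filippov.
  have [eX eY] := arc_lower (ltW lt_Lp).
  have x_lt0 : (cycle_param t).1 < 0.
    by rewrite /= eX subr_lt0; apply: g_gt; move: pT; rewrite mulr2n; lra.
  rewrite ltNge (ltW x_lt0)/= x_lt0 graph_field_Zm/= eY.
  have DQ : Q^`() = - 1 by rewrite derivB derivC derivX sub0r.
  rewrite DQ hornerN hornerC; congr (_, _).
  rewrite derivB derivC sub0r deriv_comp DQ mulrN1 opprK horner_comp QE.
  by congr (_.[_]).
Qed.

Lemma cycle_param_trajectory : trajectory (graph_field f g) cycle_param.
Proof.
split; last by apply: (phase_ae (L := L)) => // t; exact: cycle_param_derive.
move=> s t.
have [kf kf1 kfP] := poly_lipshitz f a b; have [kg kg1 kgP] := poly_lipshitz g a b.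
(* Both constants are at least 1, so [K] also dominates the unit speed of [y]. *)
pose K := kf + kg; have K0 : 0 < K by rewrite /K; lra.
have lipX : lip_on K 0 T arc_x.
  apply: (@lip_glue _ K 0 L T).
  - move=> x y x0 xy yL; have [-> _] := arc_upper yL.
    have [-> _] := arc_upper (le_trans xy yL).
    have -> : f.[a + y] - f.[a] - (f.[a + x] - f.[a]) = f.[a + y] - f.[a + x] by ring.
    have := kfP (a + x) (a + y); rewrite !in_itv/= => /(_ _ _)/le_trans -> //; [lra|lra|].
    have -> : a + y - (a + x) = y - x by ring.
    by rewrite ger0_norm ?subr_ge0// ler_wpM2r ?subr_ge0// /K; lra.
  - move=> x y Lx xy yT; have [-> _] := arc_lower Lx.
    have [-> _] := arc_lower (le_trans Lx xy).
    have -> : g.[a] - g.[b + L - y] - (g.[a] - g.[b + L - x]) = g.[b + L - x] - g.[b + L - y] by ring.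
    rewrite mulr2n in yT.
    have := kgP (b + L - y) (b + L - x); rewrite !in_itv/= => /(_ _ _)/le_trans -> //; [lra|lra|].
    have -> : b + L - x - (b + L - y) = y - x by ring.
    by rewrite ger0_norm ?subr_ge0// ler_wpM2r ?subr_ge0// /K; lra.
have lipY : lip_on K 0 T arc_y.
  apply: (@lip_glue _ K 0 L T).
  - move=> x y x0 xy yL; have [_ ->] := arc_upper yL.
    have [_ ->] := arc_upper (le_trans xy yL).
    have -> : a + y - (a + x) = y - x by ring.
    by rewrite ger0_norm ?subr_ge0// ler_peMl ?subr_ge0// /K; lra.
  - move=> x y Lx xy yT; have [_ ->] := arc_lower Lx.
    have [_ ->] := arc_lower (le_trans Lx xy).
    have -> : b + L - y - (b + L - x) = - (y - x) by ring.
    by rewrite normrN ger0_norm ?subr_ge0// ler_peMl ?subr_ge0// /K; lra.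
have L0 : 0 <= L by rewrite subr_ge0 ltW.
have LT : L <= T by rewrite mulr2n; lra.
have [X0 Y0] := arc_upper L0; have [XT YT] := arc_lower LT.
have TE : b + L - T = a by rewrite mulr2n; ring.
have perX : arc_x 0 = arc_x T by rewrite X0 XT TE addr0 !subrr.
have perY : arc_y 0 = arc_y T by rewrite Y0 YT TE addr0.
apply: (@abs_continuous_lip _ _ K) => // x y xy.
rewrite prod_normE ge_max; apply/andP; split.
  exact: (lip_periodic T_gt0 lipX perX xy).
exact: (lip_periodic T_gt0 lipY perY xy).
Qed.

Hypothesis det : f^`().[a] * g^`().[b] != f^`().[b] * g^`().[a].

Lemma isolating_nbhs : exists U : set (R * R),
  [/\ open U, cycle_curve f g a b `<=` U &
      forall G', periodic_orbit (graph_field f g) G' -> G' `<=` U ->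
        G' = cycle_curve f g a b].
Proof.
have fgab : simple_cycle f g (a, b) by split.
have [d [k [m [/= d0 abd _ near_a near_b]]]] := simple_cycle_near fgab.
have [/= fab _ _ _] := hump_f; have [/= gab _ _ _] := hump_g.
(* Not a thin tube: both open half-planes are included, and only the points of the line are
   confined, to windows around [a] and [b]. *)
exists [set q | [\/ 0 < q.1, q.1 < 0, ball a d q.2 | ball b d q.2]]; split.
- have -> : [set q | [\/ 0 < q.1, q.1 < 0, ball a d q.2 | ball b d q.2]] =
      fst @^-1` [set x : R | 0 < x] `|` fst @^-1` [set x : R | x < 0] `|`
      (snd @^-1` (ball a d) `|` snd @^-1` (ball b d)) :> set (R * R).
    apply/seteqP; split=> q /=.
      by move=> [?|?|?|?]; [left; left|left; right|right; left|right; right].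
    by move=> [[?|?]|[?|?]]; [exact: Or41|exact: Or42|exact: Or43|exact: Or44].
  have oc (h : R * R -> R) (D : set R) : continuous h -> open D -> open (h @^-1` D).
    by move=> ch oD; apply: open_comp => // q _; exact: ch.
  have c1 : continuous (fst : R * R -> R) by move=> q; exact: cvg_fst.
  have c2 : continuous (snd : R * R -> R) by move=> q; exact: cvg_snd.
  have pos : open [set x : R | 0 < x] by exact: open_gt.
  have neg : open [set x : R | x < 0] by exact: open_lt.
  apply: openU; apply: openU.
  + exact: oc c1 pos.
  + exact: oc c1 neg.
  + by apply: oc c2 _; exact: ball_open.
  + by apply: oc c2 _; exact: ball_open.
- move=> q Gq; have [q0|q0|q0] := ltgtP q.1 0; [exact: Or42|exact: Or41|].
  have : (cycle_curve f g a b `&` @disc_line R) q by [].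
  rewrite curve_disc_line => -[->|->]; [apply: Or43|apply: Or44]; exact: ballxx.
- move=> G' [w [wT [T' T'0 wT'] _ ->]] wU.
  have solw := trajectory_solution wT.
  have x_per t : (w (t + T')).1 = (w t).1 by rewrite wT'.
  have y_per t : (w (t + T')).2 = (w t).2 by rewrite wT'.
  have inU t : (w t).1 = 0 -> `|(w t).2 - a| <= d \/ `|(w t).2 - b| <= d.
    move=> w0; have : range w (w t) by exists t.
    move=> /wU /=; rewrite w0 ltxx => -[//|//|h|h]; [left|right]; rewrite distrC; exact: ltW.
  rewrite -(solution_range abd fab gab near_a near_b solw T'0 x_per y_per inU).
  by congr (image _ _); apply/funext => t; rewrite -surjective_pairing.
Qed.

Lemma phase_id t : 0 <= t < T -> phase T t = t.
Proof.
move=> tP; rewrite /phase (@turns_def _ _ T_gt0 t 0) ?mul0r ?subr0//.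
Qed.

Lemma cycle_param_range : range cycle_param = cycle_curve f g a b.
Proof.
apply/seteqP; split=> [_ [t _ <-]|[p1 p2]]; first exact: cycle_param_curve.
move=> [/= /andP[ap pb] pE].
have TE : T = L + L by rewrite mulr2n.
have upper : p1 = f.[p2] - f.[a] -> range cycle_param (p1, p2).
  move=> ->; have pL : p2 - a <= L by lra.
  exists (p2 - a) => //; rewrite /cycle_param phase_id; last by move: ab; lra.
  by have [-> ->] := arc_upper pL; rewrite subrKC.
case: pE => [|p1E]; first exact: upper.
have [p2a|p2a] := eqVneq p2 a; first by apply: upper; rewrite p1E p2a !subrr.
have {}p2a : a < p2 by rewrite lt_neqAle eq_sym p2a.
have pL : L <= L + (b - p2) by lra.
exists (L + (b - p2)) => //; rewrite /cycle_param phase_id; last by move: ab; lra.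
have [-> ->] := arc_lower pL; rewrite p1E.
have -> : b + L - (L + (b - p2)) = p2 by ring.
by [].
Qed.

Lemma crossing_limit_cycle_curve :
  crossing_limit_cycle (graph_field f g) (cycle_curve f g a b).
Proof.
have [/= _ _ fa fb] := hump_f; have [/= _ _ ga gb] := hump_g.
split; last 3 first.
- by rewrite curve_disc_line; exists (0, a); left.
- by rewrite curve_disc_line; exact: finite_set2.
- rewrite curve_disc_line => _ [->|->]; apply: graph_field_crossing.
    by rewrite mulr_gt0.
  by rewrite nmulr_rgt0.
split; last exact: isolating_nbhs.
exists cycle_param; split.
- exact: cycle_param_trajectory.
- by exists T; [exact: T_gt0|move=> t; rewrite /cycle_param phaseDT//; exact: T_gt0].
- exists L => /(congr1 snd); rewrite /cycle_param/= !phase_id ?T_gt0 ?lexx//.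
    have L0 : 0 <= L by rewrite subr_ge0 ltW.
    by rewrite (arc_upper L0).2 (arc_upper (lexx L)).2; move: ab; lra.
  by rewrite mulr2n; move: ab; lra.
- by rewrite cycle_param_range.
Qed.

End CrossingCycle.

(** * The lower bound *)

Section LowerBound.
Variable R : realType.

(** The pair is recovered from the intersection of the curve with the line, ordered by height. *)
Lemma cycle_curve_inj (f g : {poly R}) (p q : R * R) :
  simple_cycle f g p -> simple_cycle f g q ->
  cycle_curve f g p.1 p.2 = cycle_curve f g q.1 q.2 -> p = q.
Proof.
case: p q => [a b] [a' b'] [/= ab fp gp _] [/= ab' fq gq _] e.
have := curve_disc_line ab fp gp; rewrite e (curve_disc_line ab' fq gq) => E.
have mem2 (u v w : R) : [set (0, u); (0, v)] (0 : R, w) -> w = u \/ w = v.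
  by move=> [/(congr1 snd)|/(congr1 snd)] /= ->; [left|right].
have ha' : a' = a \/ a' = b by apply: mem2; rewrite -E; left.
have hb' : b' = a \/ b' = b by apply: mem2; rewrite -E; right.
have -> : a = a' by case: ha' hb' => ? [] ?; lra.
by congr (_, _); case: ha' hb' => ? [] ?; lra.
Qed.

Lemma counting_ge (T : choiceType) (S : set T) (s : seq T) :
  uniq s -> {in s, forall z, S z} -> ((size s)%:R%:E <= counting S :> \bar R)%E.
Proof.
move=> s_uniq sS; rewrite /counting; case: ifPn => [/asboolP finS|_]; last by rewrite leey.
rewrite lee_fin ler_nat; apply: uniq_leq_size => // z /sS Sz.
by rewrite in_fset_set// inE.
Qed.

Lemma Hc_ge (d N n : nat) : many_cycles R d N -> (d <= n.+1)%N ->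
  (N%:R%:E <= Hc R n)%E.
Proof.
move=> [f [g [sf sg _ _ [s [s_uniq <- scs]]]]] dn.
apply: (@le_trans _ _ (pi_c (graph_field f g))); last first.
  apply: ereal_sup_ubound; exists (graph_field f g) => //.
  have [||degP_le degQ_le] := @graph_field_degree R f g n; rewrite ?sf ?sg//.
  by split=> //; exact: graph_field_hamiltonian.
rewrite -(size_map (fun p => cycle_curve f g p.1 p.2)); apply: counting_ge.
  by rewrite map_inj_in_uniq// => p q /scs fp /scs fq; exact: cycle_curve_inj.
move=> _ /mapP[[a b] /scs [/= ab fp gp det] ->].
exact: crossing_limit_cycle_curve.
Qed.

Lemma limn_einf_ge (u : nat -> \bar R) (c : R) :
  (forall e : R, 0 < e -> exists N, forall n, (N <= n)%N -> ((c - e)%:E <= u n)%E) ->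
  (c%:E <= limn_einf u)%E.
Proof.
move=> uc; apply/lee_addgt0Pr => e e0; have [N NP] := uc e e0.
rewrite -leeBlDr// -EFinB limn_einf_lim (cvg_lim _ (@cvg_einfs_sup _ u))//.
apply: (@le_trans _ _ (einfs u N)); last by apply: ereal_sup_ubound; exists N.
by apply: le_ereal_inf_tmp => _ [n /= Nn <-]; exact: NP.
Qed.

(** Let k be the integer part of log2(n), minus j. The degree 2^k floor(n / 2^k) misses n by less
    than 2^k <= n 2^-j, and the term 2n bounds the 2^(k+1) lost in the count. *)
Lemma Hc_ge_pow2 (j n : nat) : (2 ^ j <= n)%N -> exists k N : nat,
  [/\ (N%:R%:E <= Hc R n)%E, ln n%:R <= (k + j).+1%:R * ln 2 :> R &
      k%:R * (n%:R * (1 - 2 ^- j)) - 2 * n%:R <= 2 * N%:R :> R].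
Proof.
move=> jn; have n0 : (0 < n)%N by apply: leq_trans jn; rewrite expn_gt0.
have /andP[ln_le ln_lt] := trunc_log_bounds (isT : (1 < 2)%N) n0.
set l := trunc_log 2 n in ln_le ln_lt.
have jl : (j <= l)%N by rewrite trunc_log_max.
pose k := (l - j)%N; have kj : (k + j = l)%N by rewrite subnK.
have kn : (2 ^ k * 2 ^ j <= n)%N by rewrite -expnD kj.
have [m mE] : exists m, (n %/ 2 ^ k = m.+1)%N.
  exists (n %/ 2 ^ k).-1; rewrite prednK// divn_gt0 ?expn_gt0//.
  by apply: leq_trans kn; rewrite leq_pmulr// expn_gt0.
have [N mN NE] := many_cycles_pow2 R m k.
have dn : (2 ^ k * m.+1 <= n)%N by rewrite mulnC -mE leq_trunc_div.
have nd : (n <= 2 ^ k * m.+1 + 2 ^ k)%N.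
  by rewrite {1}(divn_eq n (2 ^ k)) mE mulnC leq_add2l ltnW// ltn_pmod// expn_gt0.
exists k, N; split.
- by apply: Hc_ge mN _; exact: leqW.
- rewrite kj mulr_natl -lnXn// ler_ln ?posrE ?ltr0n ?exprn_gt0// -natrX ler_nat.
  exact: ltnW.
- have two_k : (2 ^ k)%N%:R <= n%:R * 2 ^- j :> R.
    by rewrite ler_pdivlMr ?exprn_gt0// -natrX -natrM ler_nat.
  have nd' : n%:R <= (2 ^ k * m.+1)%N%:R + (2 ^ k)%N%:R :> R by rewrite -natrD ler_nat.
  have kn' : (2 ^ k)%N%:R <= n%:R :> R.
    by rewrite ler_nat (leq_trans _ kn)// leq_pmulr// expn_gt0.
  have NE' : 2 * (2 ^ k)%N%:R + 2 * N%:R = k%:R * (2 ^ k * m.+1)%N%:R + 2 :> R.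
    by rewrite -!natrM -!natrD -expnS mul2n NE mulnA.
  have h : k%:R * (n%:R * (1 - 2 ^- j)) <= k%:R * (2 ^ k * m.+1)%N%:R :> R.
    by rewrite ler_wpM2l// mulrBr mulr1; lra.
  lra.
Qed.

Lemma Hc_asymptotics (e : R) : 0 < e -> exists N0, forall n, (N0 <= n)%N ->
  (((2 * ln 2)^-1 - e)%:E <= Hc R n * ((n%:R * ln n%:R)^-1)%:E)%E.
Proof.
move=> e0; have l2 : 0 < ln 2 :> R by rewrite ln_gt0// ltr1n.
(* Then (ln n / ln 2) 2^-j <= e ln n, which bounds the effect of the missing degree. *)
pose j := Num.bound (e * ln 2)^-1.
have jP : 2 ^- j <= e * ln 2 :> R.
  rewrite -[leRHS]invrK lef_pV2 ?posrE ?invr_gt0 ?exprn_gt0 ?mulr_gt0//.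
  apply: ltW; apply: lt_le_trans (archi_boundP _) _; first by rewrite invr_ge0 mulr_ge0// ltW.
  by rewrite -natrX ler_nat ltnW// ltn_expl.
(* j + 3 adds the gap of at most j + 1 between k and log2(n) to the 2 coming from the term 2n. *)
pose N1 := Num.bound (expR ((j.+3)%:R / e)).
exists (maxn (2 ^ j) N1) => n; rewrite geq_max => /andP[jn N1n].
have [k [N [NH lnk kN]]] := Hc_ge_pow2 jn.
have e_lt_n : expR ((j.+3)%:R / e) < n%:R :> R.
  by apply: lt_le_trans (archi_boundP (expR_ge0 _)) _; rewrite ler_nat.
have n0 : 0 < n%:R :> R := lt_trans (expR_gt0 _) e_lt_n.
have lnn : (j.+3)%:R / e < ln n%:R :> R by rewrite -ltr_expR lnK.
have lnn0 : 0 < ln n%:R :> R by apply: le_lt_trans lnn; rewrite divr_ge0// ltW.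
apply: (@le_trans _ _ (N%:R%:E * ((n%:R * ln n%:R)^-1)%:E)%E); last first.
  by apply: lee_wpmul2r => //; rewrite lee_fin invr_ge0 mulr_ge0// ltW.
rewrite -EFinM lee_fin ler_pdivlMr ?mulr_gt0//.
rewrite ltr_pdivrMr// in lnn.
set q : R := 2 ^- j in jP kN *; have q0 : 0 < q by rewrite invr_gt0 exprn_gt0.
have q1 : q <= 1 by rewrite invf_le1 ?exprn_gt0// exprn_ege1// ler1n.
set l := ln n%:R in lnk lnn lnn0 *; set x := n%:R in kN n0 *.
have k_ge : l / ln 2 - j.+1%:R <= k%:R.
  rewrite lerBlDr ler_pdivrMr// -natrD addnS; exact: lnk.
have -> : ((2 * ln 2)^-1 - e) * (x * l) = x * ((l / ln 2) / 2 - e * l).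
  by field; rewrite gt_eqF.
(* Of the slack 2 e l, one half absorbs the missing degree and the other the constant j + 3. *)
suff : x * (l / ln 2 - 2 * (e * l)) <= x * (k%:R * (1 - q) - 2).
  have -> : x * (k%:R * (1 - q) - 2) = k%:R * (x * (1 - q)) - 2 * x by ring.
  lra.
rewrite ler_pM2l//.
have h1 : (l / ln 2 - j.+1%:R) * (1 - q) <= k%:R * (1 - q).
  by rewrite ler_wpM2r// subr_ge0.
have h2 : (l / ln 2) * q <= e * l.
  have -> : l / ln 2 * q = l * (q / ln 2) by ring.
  by rewrite (mulrC e) ler_pM2l// ler_pdivrMr.
have h3 : 0 <= j.+1%:R * q by rewrite mulr_ge0// ltW.
have h4 : j.+3%:R = j.+1%:R + 2 :> R by rewrite -natrD addn2.
rewrite h4 in lnn; lra.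
Qed.

End LowerBound.

Theorem theorem2 (R : realType) :
  (((2 * ln 2)^-1)%:E <=
     limn_einf (fun n : nat => Hc R n * ((n%:R * ln n%:R)^-1)%:E))%E.
Proof. by apply: limn_einf_ge => e; exact: Hc_asymptotics. Qed.
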